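(* Let $\rho_1,\dots,\rho_K\in\mathcal{D}(\mathcal{H}_A)$ and $\sigma_{AB}\in\mathcal{D}(\mathcal{H}_A\otimes\mathcal{H}_B)$ be unknown states. Let $R$ be a finite set of nonempty strings $r=(r_1,\dots,r_{|r|})$ over the alphabet $\{1,\dots,K\}$, and for each $r\in R$ let $c_r\in\mathbb{R}$, $\phi_r\in\mathbb{R}$, and $$H_r=\tfrac12\Big(e^{i\phi_r}\rho_{r_1}\rho_{r_2}\cdots\rho_{r_{|r|}}+e^{-i\phi_r}\rho_{r_{|r|}}\rho_{r_{|r|-1}}\cdots\rho_{r_1}\Big),\qquad H=\sum_{r\in R}c_rH_r.$$ Let $c:=\sum_{r\in R}|c_r|$ and $L:=\max_{r\in R}|r|$. For $t\in\mathbb{R}$, $\delta>0$, there is a protocol (fixed independently of the unknown states) that, using $n=O(Lc^2t^2/\delta)$ samples from $\{\rho_1,\dots,\rho_K\}$, transforms $\sigma_{AB}$ into $\tilde\sigma_{AB}$ with $$\tfrac12\big\|(e^{-iHt}\otimes\mathbb{1}_B)\sigma_{AB}(e^{iHt}\otimes\mathbb{1}_B)-\tilde\sigma_{AB}\big\|_1\le O(\delta).$$ Moreover, the expected number of copies of $\rho_j$ consumed is $O(\kappa_jc^2t^2/\delta)$, where $\kappa_j=\sum_{r\in R}v_j(r)|c_r|/c$ and $v_j(r)=|\{s: r_s=j\}|$.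
   Context: $\mathcal{D}(\mathcal{H})$ denotes density operators on $\mathcal{H}$; $\|A\|_1=\operatorname{Tr}\sqrt{AA^\dagger}$.
   Formalization: In both sample bounds c²t²/δ is replaced by c²t²/δ+1 (with one absolute constant), since the literal bounds fail when c²t²/δ is tiny: they force zero samples while the error is not O(δ); Hilbert spaces are taken finite-dimensional, as is usual. *)

(* Defs.v *)
From HB Require Import structures.
From mathcomp Require Import all_boot all_order all_algebra.
From mathcomp Require Import complex mxtens.
From mathcomp Require Import boolp classical_sets reals topology normedtype sequences exp trigo.
From Stdlib Require Import ClassicalEpsilon.

Set Implicit Arguments.
Unset Strict Implicit.
Unset Printing Implicit Defensive.

Import Order.TTheory GRing.Theory Num.Theory.
Import numFieldNormedType.Exports.
Local Open Scope ring_scope.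

Section Quantum.
Variable R : realType.
Local Notation C := (complex R).

Definition adjmx m n (A : 'M[C]_(m, n)) : 'M[C]_(n, m) :=
  (map_mx (@conjc R) A)^T.

Definition psdmx n (S : 'M[C]_n) : Prop :=
  adjmx S = S /\ forall x : 'cV[C]_n, 0 <= (adjmx x *m S *m x) 0 0.

Definition density n (rho : 'M[C]_n) : Prop := psdmx rho /\ \tr rho = 1.

Definition psd_sqrt n (M : 'M[C]_n) : 'M[C]_n :=
  epsilon (inhabits 0) (fun S => psdmx S /\ S *m S = M).

Definition trnorm n (A : 'M[C]_n) : R :=
  @complex.Re R (\tr (psd_sqrt (A *m adjmx A))).

Definition exp_partial n (A : 'M[C]_n) (N : nat) : 'M[C]_n :=
  \sum_(k < N) ((k`!)%:R)^-1 *: (A ^+ k).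

Definition expmx n (A : 'M[C]_n) : 'M[C]_n :=
  \matrix_(i, j) Complex (limn (fun N => @complex.Re R (exp_partial A N i j)))
                         (limn (fun N => @complex.Im R (exp_partial A N i j))).

Definition cexpi (phi : R) : C := Complex (cos phi) (sin phi).

Definition word_prod K dA (rho : 'I_K -> 'M[C]_dA) (r : seq 'I_K) : 'M[C]_dA :=
  \prod_(j <- r) rho j.

Definition Hterm K dA (rho : 'I_K -> 'M[C]_dA) (phi : R) (r : seq 'I_K) : 'M[C]_dA :=
  (2%:R)^-1 *: (cexpi phi *: word_prod rho r + cexpi (- phi) *: word_prod rho (rev r)).

Definition Hsum K dA (rho : 'I_K -> 'M[C]_dA) (Rs : seq (seq 'I_K))
  (c phi : seq 'I_K -> R) : 'M[C]_dA :=
  \sum_(r <- Rs) ((c r)%:C)%C *: Hterm rho (phi r) r.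

Definition ctot K (Rs : seq (seq 'I_K)) (c : seq 'I_K -> R) : R :=
  \sum_(r <- Rs) `|c r|.

Definition Lmax K (Rs : seq (seq 'I_K)) : nat := \max_(r <- Rs) size r.

Definition vcount K (j : 'I_K) (r : seq 'I_K) : nat := count (pred1 j) r.

Definition kappa K (Rs : seq (seq 'I_K)) (c : seq 'I_K -> R) (j : 'I_K) : R :=
  (\sum_(r <- Rs) (vcount j r)%:R * `|c r|) / ctot Rs c.

Fixpoint samples_state K dA (rho : 'I_K -> 'M[C]_dA) (s : seq 'I_K)
  : 'M[C]_(dA ^ size s) :=
  match s return 'M[C]_(dA ^ size s) with
  | [::] => 1%:M
  | j :: s' => castmx (esym (expnS dA (size s')), esym (expnS dA (size s')))
                      (rho j *t samples_state rho s')
  end.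

(* A branch of a protocol: a (classically chosen) sequence of sample indices
   s, and a quantum channel (Kraus operators) from (samples (x) A) to A. *)
Record branch (K dA : nat) := Branch {
  br_seq : seq 'I_K;
  br_kraus : seq 'M[C]_(dA, dA ^ size br_seq * dA) }.

(* A protocol: a probability distribution over branches.  It is specified
   independently of the unknown states. *)
Definition protocol (K dA : nat) := seq (R * branch K dA).

Definition trace_preserving K dA (b : branch K dA) : Prop :=
  \sum_(E <- br_kraus b) adjmx E *m E = 1%:M.

Definition valid_protocol K dA (P : protocol K dA) : Prop :=
  (forall pb, List.In pb P -> 0 <= pb.1 /\ trace_preserving pb.2)
  /\ \sum_(pb <- P) pb.1 = 1.

Definition branch_out K dA dB (rho : 'I_K -> 'M[C]_dA) (b : branch K dA)
  (sigma : 'M[C]_(dA * dB)) : 'M[C]_(dA * dB) :=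
  let X := samples_state rho (br_seq b) *t sigma in
  \sum_(E <- br_kraus b)
    let E' := castmx (erefl (dA * dB)%N, esym (mulnA (dA ^ size (br_seq b))%N dA dB))
                     (E *t (1%:M : 'M[C]_dB)) in
    E' *m X *m adjmx E'.

Definition protocol_out K dA dB (rho : 'I_K -> 'M[C]_dA) (P : protocol K dA)
  (sigma : 'M[C]_(dA * dB)) : 'M[C]_(dA * dB) :=
  \sum_(pb <- P) ((pb.1)%:C)%C *: branch_out rho pb.2 sigma.

Definition max_samples K dA (P : protocol K dA) : nat :=
  \max_(pb <- P) size (br_seq pb.2).

Definition expected_copies K dA (P : protocol K dA) (j : 'I_K) : R :=
  \sum_(pb <- P) pb.1 * (vcount j (br_seq pb.2))%:R.

End Quantum.

(* Main.v *)
(** For a word [r] let [W] be the unitary that cyclically shifts the samples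
    and the system: tracing the samples out of [W (rho_r1 x ... x rho_rm x M)]
    leaves [rho_r1 ... rho_rm M], and [W^†] gives the reversed word.  With
    [B = (th / 2) e^(i phi) W], the two Kraus operators [1 - i (B + B^†)] and
    [B - B^†], divided by [sqrt (1 + th^2)], define a channel sending [s] to
    [(s - i th [H_r, s] + th^2 tau) / (1 + th^2)] for some state [tau].  Drawing
    [r] with probability [|c_r| / c], and giving [th] the sign of [c_r], yields
    [(s - i (th / c) [H, s] + th^2 tau) / (1 + th^2)], which for [th = c t / n]
    differs from the exact evolution over time [t / n] by [8 th^2] in trace norm,
    because [H] has norm at most [c].  Errors add up over [n] steps, to
    [8 c^2 t^2 / n], and [n] is chosen just above [c^2 t^2 / delta]. *)
Require Import Defs.
From HB Require Import structures.
From mathcomp Require Import all_boot all_order all_algebra.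
From mathcomp Require Import complex mxtens.
From mathcomp Require Import ring lra.
From mathcomp Require Import boolp classical_sets reals topology normedtype.
From mathcomp Require Import sequences exp trigo derive.
From Stdlib Require Import ClassicalEpsilon.

Set Implicit Arguments.
Unset Strict Implicit.
Unset Printing Implicit Defensive.

Import Order.TTheory GRing.Theory Num.Theory.
Import numFieldNormedType.Exports.
Local Open Scope ring_scope.

Local Notation "A ^†" := (adjmx A) (at level 1, format "A ^†").
Local Notation "x %:RC" := (real_complex _ x) (at level 1, format "x %:RC").

(** * Adjoints, spectral calculus and positive semidefinite matrices *)

Section Adjoint.
Variable R : realType.
Local Notation C := (complex R).

(** Three points shape the argument. The square root inside [trnorm] is only a chosen one, so every
    estimate is carried by a dominating positive matrix and converted to [trnorm] at the very end.
    Next, [tau] has to be a state even when the system is entangled with [B]: it is exhibited as the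
    output of a second protocol, which for each word applies [W] or [W^†] with probability 1/2 and
    discards the samples, so its positivity and trace are those of any protocol output. Finally, the
    shift gives identities on [A] alone, while the joint state need not be a product; both sides
    being additive, agreement on products [M *t N] suffices. All operator bounds are read in one
    eigenbasis of [H], where the generator, its exponential and the Taylor remainders are
    simultaneously diagonal, and tensoring with the identity of [B] does not change them. The factor
    [1 / (1 + th^2)] is what keeps the bound [8 th^2] valid for every [th], large steps included. *)

Lemma adjmxK m n (A : 'M[C]_(m, n)) : A^†^† = A.
Proof. by apply/matrixP => i j; rewrite !mxE conjcK. Qed.

Lemma adjmxD m n (A B : 'M[C]_(m, n)) : (A + B)^† = A^† + B^†.
Proof. by rewrite /adjmx map_mxD linearD. Qed.

Lemma adjmxN m n (A : 'M[C]_(m, n)) : (- A)^† = - A^†.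
Proof. by rewrite /adjmx map_mxN linearN. Qed.

Lemma adjmxB m n (A B : 'M[C]_(m, n)) : (A - B)^† = A^† - B^†.
Proof. by rewrite adjmxD adjmxN. Qed.

Lemma adjmxZ m n (a : C) (A : 'M[C]_(m, n)) : (a *: A)^† = conjc a *: A^†.
Proof. by rewrite /adjmx map_mxZ linearZ. Qed.

Lemma adjmxM m n p (A : 'M[C]_(m, n)) (B : 'M[C]_(n, p)) :
  (A *m B)^† = B^† *m A^†.
Proof. by rewrite /adjmx map_mxM trmx_mul. Qed.

Lemma adjmx1 n : (1%:M : 'M[C]_n)^† = 1%:M.
Proof. by rewrite /adjmx map_mx1 trmx1. Qed.

Lemma adjmx0 m n : (0 : 'M[C]_(m, n))^† = 0.
Proof. by rewrite /adjmx map_mx0 trmx0. Qed.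

Lemma adjmx_sum m n I (s : seq I) (P : pred I) (F : I -> 'M[C]_(m, n)) :
  (\sum_(i <- s | P i) F i)^† = \sum_(i <- s | P i) (F i)^†.
Proof. by rewrite /adjmx map_mx_sum linear_sum. Qed.

Lemma adjmx_tens m n p q (A : 'M[C]_(m, n)) (B : 'M[C]_(p, q)) :
  (A *t B)^† = A^† *t B^†.
Proof. by rewrite /adjmx map_mxT trmx_tens. Qed.

Lemma adjmx_cast m n m' n' (e1 : m = m') (e2 : n = n') (A : 'M[C]_(m, n)) :
  (castmx (e1, e2) A)^† = castmx (e2, e1) A^†.
Proof. by case: m' / e1; case: n' / e2. Qed.

Lemma conjc_RC (x : R) : conjc (x%:RC) = x%:RC.
Proof. exact: conjc_real. Qed.

Lemma conjcM (x y : C) : conjc (x * y) = conjc x * conjc y.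
Proof. exact: rmorphM. Qed.

Lemma adjmxZR m n (a : R) (A : 'M[C]_(m, n)) : (a%:RC *: A)^† = a%:RC *: A^†.
Proof. by rewrite adjmxZ conjc_RC. Qed.

(** Functional calculus: for a fixed unitary [V] all operations on these matrices are pointwise in
    [f], so matrix identities and inequalities reduce to scalars. *)
Definition udiag n (V : 'M[C]_n) (f : 'I_n -> C) : 'M[C]_n :=
  V^† *m diag_mx (\row_i f i) *m V.

Lemma herm_spectral n (A : 'M[C]_n) : A^† = A ->
  exists V (l : 'I_n -> R), V *m V^† = 1%:M /\ A = udiag V (fun i => (l i)%:RC).
Proof.
move=> hA.
have hA' : A \is hermsymmx.
  by apply/is_hermitianmxP; rewrite expr0 scale1r -[LHS]hA; apply/matrixP => i j; rewrite !mxE.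
have hN := hermitian_normalmx hA'.
have /unitarymxP hU := spectral_unitarymx A.
have hr := hermitian_spectral_diag_real hA'.
have eadj : (spectralmx A)^† = (spectralmx A ^t* )%sesqui.
  by apply/matrixP => i j; rewrite !mxE.
have eA := orthomx_spectralP hN.
rewrite (invmx_unitary (spectral_unitarymx A)) -eadj in eA.
rewrite -eadj in hU.
exists (spectralmx A), (fun i => complex.Re (spectral_diag A 0 i)).
split; first exact: hU.
rewrite [LHS]eA /udiag.
have -> : \row_i (complex.Re (spectral_diag A 0 i))%:RC = spectral_diag A.
  apply/rowP => i; rewrite mxE; apply: RRe_real.
  by have /mxOverP := hr; apply.
by [].
Qed.

Section Udiag.
Variables (n : nat) (V : 'M[C]_n) (VV : V *m V^† = 1%:M).

Lemma udiagD f g : udiag V f + udiag V g = udiag V (fun i => f i + g i).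
Proof.
rewrite /udiag -mulmxDl -mulmxDr -linearD; congr (_ *m diag_mx _ *m _).
by apply/rowP => i; rewrite !mxE.
Qed.

Lemma udiagZ a f : a *: udiag V f = udiag V (fun i => a * f i).
Proof.
rewrite /udiag scalemxAl scalemxAr -linearZ; congr (_ *m diag_mx _ *m _).
by apply/rowP => i; rewrite !mxE.
Qed.

Lemma udiagN f : - udiag V f = udiag V (fun i => - f i).
Proof.
rewrite -scaleN1r udiagZ; congr (udiag V _).
by apply/funext => i; rewrite mulN1r.
Qed.

Lemma udiagB f g : udiag V f - udiag V g = udiag V (fun i => f i - g i).
Proof. by rewrite udiagN udiagD. Qed.

Lemma udiagM f g : udiag V f *m udiag V g = udiag V (fun i => f i * g i).
Proof.
rewrite /udiag !mulmxA -[_ *m V *m V^†]mulmxA VV mulmx1.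
rewrite -[V^† *m _ *m diag_mx _]mulmxA mulmx_diag; congr (_ *m diag_mx _ *m _).
by apply/rowP => i; rewrite !mxE.
Qed.

Lemma udiag_adj f : (udiag V f)^† = udiag V (fun i => conjc (f i)).
Proof.
rewrite /udiag !adjmxM adjmxK mulmxA; congr (_ *m _ *m _).
apply/matrixP => i j; rewrite !mxE eq_sym; case: eqP => [->|_].
  by rewrite !mulr1n.
by rewrite !mulr0n conjc0.
Qed.

Lemma udiag_cst a : udiag V (fun=> a) = a%:M.
Proof.
rewrite /udiag; have -> : diag_mx (\row_(i < n) a) = a%:M.
  by apply/matrixP => i j; rewrite !mxE.
by rewrite -mulmxA -scalemx1 -scalemxAl mul1mx -scalemxAr (mulmx1C VV).
Qed.

Lemma udiag_tr f : \tr (udiag V f) = \sum_i f i.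
Proof.
rewrite /udiag mxtrace_mulC mulmxA VV mul1mx mxtrace_diag.
by apply: eq_bigr => i _; rewrite mxE.
Qed.

(** Eigenvalues appear as diagonal entries after conjugation by [V]; this is how positivity of a
    matrix reaches them. *)
Lemma udiag_entry f i : (V *m udiag V f *m V^†) i i = f i.
Proof.
rewrite /udiag !mulmxA VV mul1mx -mulmxA VV mulmx1.
by rewrite !mxE eqxx.
Qed.

Lemma udiagX f k : udiag V f ^+ k = udiag V (fun i => f i ^+ k).
Proof.
elim: k => [|k IH]; first by rewrite expr0 -[1]/(1%:M) -udiag_cst.
rewrite exprS IH -[_ * _]/(_ *m _) udiagM; congr (udiag V _).
by apply/funext => i; rewrite exprS.
Qed.

End Udiag.

Lemma psdmx_gram m n (B : 'M[C]_(m, n)) : psdmx (B^† *m B).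
Proof.
split; first by rewrite adjmxM adjmxK.
move=> x; rewrite mulmxA -adjmxM -mulmxA mxE; apply: sumr_ge0 => i _.
by rewrite !mxE mulrC mulcJ_ge0.
Qed.

Lemma psdmxD n (A B : 'M[C]_n) : psdmx A -> psdmx B -> psdmx (A + B).
Proof.
move=> [hA pA] [hB pB]; split; first by rewrite adjmxD hA hB.
by move=> x; rewrite mulmxDr mulmxDl mxE addr_ge0.
Qed.

Lemma psdmx0 n : psdmx (0 : 'M[C]_n).
Proof. by split=> [|x]; rewrite ?adjmx0 // mulmx0 mul0mx mxE. Qed.

Lemma psdmx_sum n I (s : seq I) (P : pred I) (F : I -> 'M[C]_n) :
  (forall i, P i -> psdmx (F i)) -> psdmx (\sum_(i <- s | P i) F i).
Proof.
move=> h; elim/big_rec: _ => [|i A Pi pA]; first exact: psdmx0.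
exact: (psdmxD (h i Pi) pA).
Qed.

Lemma psdmxZ n (a : R) (A : 'M[C]_n) : 0 <= a -> psdmx A -> psdmx (a%:RC *: A).
Proof.
move=> a0 [hA pA]; split; first by rewrite adjmxZR hA.
by move=> x; rewrite -scalemxAr -scalemxAl mxE mulr_ge0 ?ler0c.
Qed.

Lemma psdmx_conj m n (B : 'M[C]_(m, n)) (P : 'M[C]_n) :
  psdmx P -> psdmx (B *m P *m B^†).
Proof.
move=> [hP pP]; split; first by rewrite !adjmxM adjmxK hP mulmxA.
by move=> x; have := pP (B^† *m x); rewrite adjmxM adjmxK !mulmxA.
Qed.

Lemma psdmx_diag_ge0 n (A : 'M[C]_n) i : psdmx A -> 0 <= A i i.
Proof.
move=> [_ /(_ (delta_mx i 0))]; rewrite -mulmxA -colE.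
have -> : (delta_mx i 0 : 'cV[C]_n)^† = delta_mx 0 i.
  apply/matrixP => j k; rewrite !mxE andbC.
  by case: (_ && _); rewrite ?conjc1 ?conjc0.
by rewrite -rowE !mxE.
Qed.

Lemma psdmx_tr_ge0 n (A : 'M[C]_n) : psdmx A -> 0 <= \tr A.
Proof. by move=> pA; apply: sumr_ge0 => i _; apply: psdmx_diag_ge0. Qed.

Lemma psdmx_udiag n (V : 'M[C]_n) (f : 'I_n -> R) :
  (forall i, 0 <= f i) -> psdmx (udiag V (fun i => (f i)%:RC)).
Proof.
move=> f0; rewrite /udiag.
set D := diag_mx _.
have -> : D = (diag_mx (\row_i (Num.sqrt (f i))%:RC)) *m
              (diag_mx (\row_i (Num.sqrt (f i))%:RC))^†.
  apply/matrixP => i j; rewrite mul_diag_mx !mxE eq_sym.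
  case: eqP => [->|_]; last by rewrite !mulr0n conjc0 mulr0.
  by rewrite !mulr1n conjc_RC -rmorphM /= -expr2 sqr_sqrtr.
rewrite !mulmxA.
have := psdmx_gram ((V^† *m diag_mx (\row_i (Num.sqrt (f i))%:RC))^†).
by rewrite adjmxK adjmxM adjmxK mulmxA.
Qed.

Lemma psdmx_spectral n (A : 'M[C]_n) : psdmx A ->
  exists V (l : 'I_n -> R), [/\ V *m V^† = 1%:M, forall i, 0 <= l i
    & A = udiag V (fun i => (l i)%:RC)].
Proof.
move=> pA; have [hA _] := pA; have [V [l [VV eA]]] := herm_spectral hA.
exists V, l; split=> // i; rewrite -ler0c -[X in 0 <= X](udiag_entry VV (fun i => (l i)%:RC)) -eA.
exact/psdmx_diag_ge0/psdmx_conj.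
Qed.

(** Writing a positive matrix as [Q *m Q^†] turns positivity of tensor products and of traces of
    products into that of Gram matrices. *)
Lemma psdmx_factor n (A : 'M[C]_n) : psdmx A -> exists Q : 'M[C]_n, A = Q *m Q^†.
Proof.
move=> /psdmx_spectral[V [l [VV l0 ->]]].
exists (udiag V (fun i => (Num.sqrt (l i))%:RC)).
rewrite udiag_adj udiagM //; congr (udiag V _); apply/funext => i.
by rewrite conjc_RC -rmorphM /= -expr2 sqr_sqrtr.
Qed.

Lemma psdmx_tens m n (A : 'M[C]_m) (B : 'M[C]_n) :
  psdmx A -> psdmx B -> psdmx (A *t B).
Proof.
move=> /psdmx_factor[Q ->] /psdmx_factor[S ->].
rewrite -tensmx_mul -adjmx_tens -{1}[Q *t S]adjmxK.
exact: psdmx_gram.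
Qed.

Lemma psdmx_tr_mul_ge0 n (A B : 'M[C]_n) : psdmx A -> psdmx B -> 0 <= \tr (A *m B).
Proof.
move=> pA /psdmx_factor[Q ->].
rewrite mulmxA mxtrace_mulC mulmxA; apply: psdmx_tr_ge0.
by have := psdmx_conj (Q^†) pA; rewrite adjmxK.
Qed.

(* With [X = S - T] and [Y = S + T] one has [X Y + Y X = 2 (S^2 - T^2) = 0]:
   in an eigenbasis of [X], an eigenvalue [x_i != 0] forces [Y_ii = 0], hence
   [S_ii = T_ii = 0] and [x_i = 0]. *)
Lemma psd_sqrt_tr_unique n (S T : 'M[C]_n) :
  psdmx S -> psdmx T -> S *m S = T *m T -> \tr S = \tr T.
Proof.
move=> pS pT ST; have [hS _] := pS; have [hT _] := pT.
have [V [l [VV e]]] : exists V (l : 'I_n -> R), V *m V^† = 1%:M /\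
    S - T = udiag V (fun i => (l i)%:RC).
  by apply: herm_spectral; rewrite adjmxB hS hT.
apply/eqP; rewrite -subr_eq0 -raddfB /= e udiag_tr // big1 // => i _.
set s := (V *m S *m V^†) i i; set u := (V *m T *m V^†) i i.
have s0 : 0 <= s by apply/psdmx_diag_ge0/psdmx_conj.
have u0 : 0 <= u by apply/psdmx_diag_ge0/psdmx_conj.
have lE : (l i)%:RC = s - u.
  by rewrite -[LHS](udiag_entry VV (fun i => (l i)%:RC)) -e mulmxBr mulmxBl mxE [X in _ + X]mxE.
have XY : (S - T) *m (S + T) + (S + T) *m (S - T) = 0.
  rewrite !mulmxDr !mulmxDl !mulmxN !mulNmx ST.
  move: (S *m T) (T *m S) (T *m T) => x y z.
  by apply/matrixP => a b; rewrite !mxE; ring.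
have : (l i)%:RC * (s + u) + (s + u) * (l i)%:RC = 0.
  pose D := diag_mx (\row_j (l j)%:RC).
  have e1 : V *m (S - T) = D *m V by rewrite e /udiag !mulmxA VV mul1mx.
  have e2 : (S - T) *m V^† = V^† *m D by rewrite e /udiag -mulmxA VV mulmx1.
  have e3 : D *m (V *m (S + T) *m V^†) + (V *m (S + T) *m V^†) *m D = 0.
    rewrite !mulmxA -e1 -[_ *m V^† *m D]mulmxA -e2 !mulmxA.
    rewrite -mulmxDl -2!(mulmxA V) -mulmxDr XY.
    by rewrite mulmx0 mul0mx.
  have := congr1 (fun M : 'M_n => M i i) e3.
  rewrite mul_diag_mx mul_mx_diag mulmxDr mulmxDl.
  move: (V *m S *m V^†) (V *m T *m V^†) @s @u {s0 u0 lE} => s u.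
  by rewrite !mxE.
rewrite [_ * (l i)%:RC]mulrC -mulr2n => /eqP; rewrite mulrn_eq0 /= mulf_eq0.
case/orP => /eqP // su0.
move/eqP: su0; rewrite paddr_eq0 // => /andP[/eqP s_0 /eqP u_0].
by rewrite lE s_0 u_0 subrr.
Qed.

(* [-P <= A <= P] with [\tr P <= a] bounds the trace norm of a Hermitian [A], and
   unlike [trnorm] it is visibly subadditive. *)
Definition trbound n (A : 'M[C]_n) (a : R) :=
  exists P, [/\ psdmx (P - A), psdmx (P + A) & \tr P <= a%:RC].

Lemma trbound_herm n (A : 'M[C]_n) a : trbound A a -> A^† = A.
Proof.
move=> [P [[h1 _] [h2 _] _]].
have : A + A = (P + A) - (P - A) by apply/matrixP => i j; rewrite !mxE; ring.
move=> e; have : (A + A)^† = A + A by rewrite e adjmxB h1 h2.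
rewrite adjmxD -!mulr2n => /matrixP h; apply/matrixP => i j.
by have := h i j; rewrite !(mulr2n, mxE) -!mulr2n => /(pmulrnI (isT : (0 < 2)%N)).
Qed.

(** In an eigenbasis of [A] the trace norm is the sum of the [|l i|], and the two positivity
    conditions bound each of them by a diagonal entry of the dominating matrix. *)
Lemma trnorm_le n (A : 'M[C]_n) a : trbound A a -> trnorm A <= a.
Proof.
move=> tA; have hA := trbound_herm tA; case: tA => P [p1 p2 tP].
have [V [l [VV eA]]] := herm_spectral hA.
pose T := udiag V (fun i => (`|l i|)%:RC).
have pT : psdmx T by apply: psdmx_udiag => i.
have TT : T *m T = A *m A^†.
  rewrite hA eA !udiagM //; congr (udiag V _); apply/funext => i.
  by rewrite -!rmorphM /= -!expr2 real_normK ?num_real.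
rewrite /trnorm /psd_sqrt.
set S := epsilon _ _.
(* The matrix [T = |A|] shows that a positive root exists, so the chosen [S] is one too; only its
   trace needs to agree with that of [T]. *)
have [pS SS] : psdmx S /\ S *m S = A *m A^†.
  exact: (epsilon_spec (inhabits 0)
    (fun S => psdmx S /\ S *m S = A *m A^†) (ex_intro _ T (conj pT TT))).
rewrite (@psd_sqrt_tr_unique _ S T) ?SS //.
suff : \tr T <= a%:RC by rewrite lecE /= => /andP[].
apply: le_trans tP; rewrite udiag_tr //.
have -> : \tr P = \tr (V *m P *m V^†).
  by rewrite mxtrace_mulC mulmxA (mulmx1C VV) mul1mx.
apply: ler_sum => i _.
have lE : (l i)%:RC = (V *m A *m V^†) i i by rewrite eA udiag_entry.
have q1 : 0 <= (V *m P *m V^†) i i - (l i)%:RC.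
  by have := psdmx_diag_ge0 i (psdmx_conj V p1); rewrite lE mulmxBr mulmxBl mxE [X in _ + X]mxE.
have q2 : 0 <= (V *m P *m V^†) i i + (l i)%:RC.
  by have := psdmx_diag_ge0 i (psdmx_conj V p2); rewrite lE mulmxDr mulmxDl mxE.
case: (ger0P (l i)) => _; first by rewrite -subr_ge0.
by rewrite rmorphN /= -subr_ge0 opprK.
Qed.

Lemma trboundD n (A B : 'M[C]_n) a b :
  trbound A a -> trbound B b -> trbound (A + B) (a + b).
Proof.
move=> [P [p1 p2 tP]] [Q [q1 q2 tQ]]; exists (P + Q); split.
- by rewrite opprD addrACA; exact: (psdmxD p1 q1).
- by rewrite addrACA; exact: (psdmxD p2 q2).
- by rewrite raddfD rmorphD lerD.
Qed.

Lemma trboundN n (A : 'M[C]_n) a : trbound A a -> trbound (- A) a.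
Proof. by move=> [P [p1 p2 tP]]; exists P; split; rewrite ?opprK. Qed.

Lemma trboundB n (A B : 'M[C]_n) a b :
  trbound A a -> trbound B b -> trbound (A - B) (a + b).
Proof. by move=> tA tB; apply/trboundD/trboundN. Qed.

Lemma trboundZ n (A : 'M[C]_n) a x :
  0 <= x -> trbound A a -> trbound (x%:RC *: A) (x * a).
Proof.
move=> x0 [P [p1 p2 tP]]; exists (x%:RC *: P); split.
- by rewrite -scalerBr; exact: (psdmxZ x0 p1).
- by rewrite -scalerDr; exact: (psdmxZ x0 p2).
- by rewrite linearZ rmorphM /= ler_wpM2l ?ler0c.
Qed.

Lemma trbound_psd n (A : 'M[C]_n) a : psdmx A -> \tr A <= a%:RC -> trbound A a.
Proof.
move=> pA tA; exists A; split; [|exact: (psdmxD pA pA)|exact: tA].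
rewrite subrr; exact: psdmx0.
Qed.

Lemma trbound_le n (A : 'M[C]_n) a b : a <= b -> trbound A a -> trbound A b.
Proof.
move=> ab [P [p1 p2 tP]]; exists P; split=> //.
by apply: le_trans tP _; rewrite lecR.
Qed.

Lemma trbound_unitary n (U A : 'M[C]_n) a :
  U^† *m U = 1%:M -> trbound A a -> trbound (U *m A *m U^†) a.
Proof.
move=> UU [P [p1 p2 tP]]; exists (U *m P *m U^†); split.
- by rewrite -mulmxBl -mulmxBr; exact: (psdmx_conj U p1).
- by rewrite -mulmxDl -mulmxDr; exact: (psdmx_conj U p2).
- by rewrite mxtrace_mulC mulmxA UU mul1mx.
Qed.

Lemma tr_conj_le n (A s : 'M[C]_n) (k : R) : psdmx s -> \tr s = 1 ->
  psdmx (k%:RC%:M - A^† *m A) -> \tr (A *m s *m A^†) <= k%:RC.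
Proof.
move=> ps ts pA; have := psdmx_tr_mul_ge0 pA ps.
rewrite mulmxBl raddfB /= mul_scalar_mx linearZ /= ts mulr1 subr_ge0.
have -> : \tr (A *m s *m A^†) = \tr (A^† *m A *m s) by rewrite mxtrace_mulC mulmxA.
by [].
Qed.

(* AM-GM: both [A s + s A^†] and its opposite are at most [e A s A^† + s / e]. *)
Lemma trbound_anticomm n (A s : 'M[C]_n) (k e : R) : density s -> 0 < e ->
  psdmx (k%:RC%:M - A^† *m A) ->
  trbound (A *m s + s *m A^†) (e * k + e^-1).
Proof.
move=> [ps ts] e0 pA.
(* Used with [x = 1] and [x = -1]: the matrix is [e (A + x/e) s (A + x/e)^†], expanded. *)
have key (x : C) : x ^+ 2 = 1 -> conjc x = x -> psdmx (e%:RC *: (A *m s *m A^†) + e^-1%:RC *: s +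
    x *: (A *m s + s *m A^†)).
  move=> x2 cx.
  have := psdmxZ (ltW e0) (psdmx_conj (A + (e^-1%:RC * x)%:M) ps).
  suff -> : e%:RC *: ((A + (e^-1%:RC * x)%:M) *m s *m (A + (e^-1%:RC * x)%:M)^†)
     = e%:RC *: (A *m s *m A^†) + e^-1%:RC *: s + x *: (A *m s + s *m A^†) by [].
  have ee : e%:RC * e^-1%:RC = 1 :> C by rewrite -rmorphM /= divff ?gt_eqF.
  set a := e^-1%:RC * x.
  have ca : conjc a = a by rewrite /a conjcM conjc_RC cx.
  have ea : e%:RC * a = x by rewrite /a mulrA ee mul1r.
  have eaa : x * a = e^-1%:RC by rewrite /a mulrCA -expr2 x2 mulr1.
  clearbody a.
  rewrite -scalemx1 adjmxD adjmxZ adjmx1 ca !mulmxDl !mulmxDr.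
  rewrite -!scalemxAl -!scalemxAr !mul1mx !mulmx1.
  rewrite !scalerDr !scalerA ?mulrA !ea eaa -!addrA; congr (_ + _).
  by rewrite addrA addrC.
exists (e%:RC *: (A *m s *m A^†) + e^-1%:RC *: s); split.
- by rewrite -scaleN1r; apply: key; rewrite ?sqrrN ?expr1n // rmorphN rmorph1.
- by rewrite -[X in _ + X]scale1r; apply: key; rewrite ?expr1n ?rmorph1.
- rewrite raddfD /= !linearZ /= ts mulr1 rmorphD rmorphM lerD2r ler_wpM2l ?ler0c ?(ltW e0) //.
  exact: tr_conj_le.
Qed.

End Adjoint.

(** * Trigonometric estimates and the matrix exponential *)

Section Exponential.
Local Open Scope classical_set_scope.
Local Open Scope ring_scope.
Variable R : realType.
Local Notation C := (complex R).

(** Both signs of [x] are treated at once, so that applying it repeatedly gives the polynomial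
    bounds on sine and cosine below. *)
Lemma mean_value0 (f df : R -> R) (x : R) :
  (forall y : R, is_derive y (1 : R) f (df y)) -> f 0 = 0 ->
  exists2 y, `|y| <= `|x| & f x = df y * x.
Proof.
move=> hf f0.
have cf : forall a b : R, {within `[a, b], continuous f}.
  move=> a b; apply: continuous_subspaceT => y.
  by apply/differentiable_continuous/derivable1_diffP; have [] := hf y.
have [x0|x0] := leP 0 x.
  have [y + e] := MVT_segment x0 (fun y _ => hf y) (cf _ _).
  rewrite in_itv /= => /andP[y0 yx]; exists y; first by rewrite !ger0_norm.
  by move: e; rewrite f0 !subr0.
have [y + e] := MVT_segment (ltW x0) (fun y _ => hf y) (cf _ _).
rewrite in_itv /= => /andP[y0 yx]; exists y.
  by rewrite !ler0_norm ?(ltW x0) // lerN2.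
by move: e; rewrite f0 !sub0r mulrN => /oppr_inj.
Qed.

Lemma normr_sin_le (x : R) : `|sin x| <= `|x|.
Proof.
have [y _ ->] := mean_value0 x (@is_derive_sin R) (@sin0 R).
by rewrite normrM ler_piMl // ler_norml cos_geN1 cos_le1.
Qed.

Lemma normr_cos1_le (x : R) : `|cos x - 1| <= x ^+ 2.
Proof.
have [||y yx ->] := @mean_value0 (fun x => cos x - 1) (fun x => - sin x) x.
- by move=> y; rewrite -[X in is_derive _ _ _ X]subr0; apply: is_deriveB.
- by rewrite cos0 subrr.
rewrite mulNr normrN normrM -[leRHS]real_normK ?num_real // expr2 ler_pM //.
exact: le_trans (normr_sin_le _) yx.
Qed.

(** A quadratic bound matches the cosine one, and together they give [|e^(ix) - 1 - ix|^2 <= 2 x^4],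
    the order that the step error requires. *)
Lemma normr_sinB_le (x : R) : `|sin x - x| <= x ^+ 2.
Proof.
have [|y yx ->] := @mean_value0 (fun x => sin x - x) (fun x => cos x - 1) x.
  by rewrite sin0 subrr.
have [||z zy ->] := @mean_value0 (fun x => cos x - 1) (fun x => - sin x) y.
- by move=> w; rewrite -[X in is_derive _ _ _ X]subr0; apply: is_deriveB.
- by rewrite cos0 subrr.
rewrite normrM -[leRHS]real_normK ?num_real // expr2 ler_pM //.
rewrite normrM normrN -[leRHS]mul1r ler_pM // ler_norml.
by rewrite sin_geN1 sin_le1.
Qed.

Lemma cexpi_sub1_sqr (x : R) :
  conjc (cexpi x - 1) * (cexpi x - 1) = (2 * (1 - cos x))%:RC.
Proof.
rewrite /cexpi; apply/eqP; rewrite eq_complex /=; apply/andP; split; apply/eqP; last by ring.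
have := cos2Dsin2 x; set a := cos x; set b := sin x => h.
have -> : 2 * (1 - a) = (a ^+ 2 + b ^+ 2) + 1 - 2 * a by rewrite h; ring.
ring.
Qed.

Lemma cexpi_sub2_sqr (x : R) :
  conjc (cexpi x - 1 - Complex 0 x) * (cexpi x - 1 - Complex 0 x) =
  ((cos x - 1) ^+ 2 + (sin x - x) ^+ 2)%:RC.
Proof.
rewrite /cexpi; apply/eqP; rewrite eq_complex /=.
by apply/andP; split; apply/eqP; ring.
Qed.

(** The exponential series of [ix] splits termwise into the cosine and sine series. For [k = 0] the
    truncated predecessor in the sine term is harmless, as its parity factor is zero. *)
Lemma expi_term (x : R) k :
  ((k`!)%:R)^-1 * Complex 0 x ^+ k = Complex (cos_coeff x k) (sin_coeff x k) :> C.
Proof.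
have E : Complex 0 x ^+ k = Complex ((~~ odd k)%:R * (-1) ^+ k./2 * x ^+ k)
     ((odd k)%:R * (-1) ^+ k.-1./2 * x ^+ k) :> C.
  elim: k => [|k IH]; first by rewrite !expr0 /= !mulr1.
  rewrite exprSr IH.
  apply/eqP; rewrite eq_complex /= !mulr0 ?addr0 ?add0r ?subr0 ?sub0r.
  case ok: (odd k) => /=; rewrite ?mul0r ?mul1r ?oppr0 ?eqxx ?andbT /=.
    case: k ok {IH} => [//|k] /= ok.
    by rewrite (exprS (-1)) mulN1r mulNr (exprSr x k.+1) mulrA.
  by rewrite exprSr mulrA.
rewrite E /cos_coeff /sin_coeff.
have -> : (k`!%:R : C) = (k`!%:R : R)%:RC by rewrite rmorph_nat.
rewrite -fmorphV /=; apply/eqP; rewrite eq_complex /=.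
by rewrite !mul0r subr0 addr0 ![k`!%:R^-1 * _]mulrC; apply/andP; split; apply/eqP.
Qed.

Lemma exp_partial_udiag n (V : 'M[C]_n) f N : V *m V^† = 1%:M ->
  exp_partial (udiag V f) N =
  udiag V (fun i => \sum_(k < N) ((k`!)%:R)^-1 * f i ^+ k).
Proof.
move=> VV; rewrite /exp_partial; elim: N => [|N IH].
  rewrite big_ord0 -[LHS](scale0r (udiag V f)) udiagZ; congr (udiag V _).
  by apply/funext => i; rewrite big_ord0 mul0r.
rewrite big_ord_recr /= IH udiagX // udiagZ udiagD; congr (udiag V _).
by apply/funext => i; rewrite big_ord_recr.
Qed.

Lemma sum_complex N (a b : nat -> R) :
  \sum_(k < N) Complex (a k) (b k) = Complex (series a N) (series b N).
Proof.
rewrite /series /= !big_mkord; elim: N => [|N IH]; first by rewrite !big_ord0.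
by rewrite !big_ord_recr /= IH.
Qed.

(** The entries are linear in [f] with coefficients independent of [f], so the entrywise limits that
    define [expmx] pass to the eigenvalues. *)
Lemma udiagE n (V : 'M[C]_n) f a b :
  (udiag V f) a b = \sum_i f i * (conjc (V i a) * V i b).
Proof.
rewrite /udiag mul_mx_diag mxE; apply: eq_bigr => i _.
by rewrite !mxE mulrCA mulrA.
Qed.

Lemma ReE_sum I (s : seq I) (f w : I -> C) :
  complex.Re (\sum_(i <- s) f i * w i) =
  \sum_(i <- s) (complex.Re (f i) * complex.Re (w i) - complex.Im (f i) * complex.Im (w i)).
Proof.
elim: s => [|i s IH]; first by rewrite !big_nil.
by rewrite !big_cons -IH; case: (f i) (w i) => [? ?] [? ?]; case: (\sum_(_ <- _) _).
Qed.

Lemma ImE_sum I (s : seq I) (f w : I -> C) :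
  complex.Im (\sum_(i <- s) f i * w i) =
  \sum_(i <- s) (complex.Re (f i) * complex.Im (w i) + complex.Im (f i) * complex.Re (w i)).
Proof.
elim: s => [|i s IH]; first by rewrite !big_nil.
by rewrite !big_cons -IH; case: (f i) (w i) => [? ?] [? ?]; case: (\sum_(_ <- _) _).
Qed.

Lemma cvg_sum_seq I (s : seq I) (u : I -> nat -> R) (l : I -> R) :
  (forall i, u i @ \oo --> l i) ->
  (fun N => \sum_(i <- s) u i N) @ \oo --> \sum_(i <- s) l i.
Proof.
move=> h; elim: s => [|i s IH].
  rewrite big_nil (_ : (fun _ => _) = fun=> 0); first exact: cvg_cst.
  by apply/funext => N; rewrite big_nil.
rewrite big_cons (_ : (fun _ => _) = (fun N => u i N + \sum_(j <- s) u j N)).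
  exact: cvgD.
by apply/funext => N; rewrite big_cons.
Qed.

Lemma expmx_udiag n (V : 'M[C]_n) (x : 'I_n -> R) : V *m V^† = 1%:M ->
  expmx (udiag V (fun i => Complex 0 (x i))) = udiag V (fun i => cexpi (x i)).
Proof.
move=> VV; apply/matrixP => a b; rewrite mxE.
have E N : exp_partial (udiag V (fun i => Complex 0 (x i))) N a b =
    \sum_i Complex (series (cos_coeff (x i)) N) (series (sin_coeff (x i)) N) *
           (conjc (V i a) * V i b).
  rewrite exp_partial_udiag // udiagE; apply: eq_bigr => i _; congr (_ * _).
  by rewrite -sum_complex; apply: eq_bigr => k _; rewrite expi_term.
have cc i : series (cos_coeff (x i)) @ \oo --> cos (x i).
  by rewrite unlock; apply: is_cvg_series_cos_coeff.
have cs i : series (sin_coeff (x i)) @ \oo --> sin (x i).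
  by rewrite unlock; apply: is_cvg_series_sin_coeff.
rewrite udiagE; apply/eqP; rewrite eq_complex; apply/andP; split; apply/eqP.
  rewrite /= ReE_sum /cexpi /=; apply/cvg_lim => //.
  under eq_cvg do rewrite E ReE_sum /=.
  apply: cvg_sum_seq => i; apply: cvgB; apply: cvgMl; [exact: cc|exact: cs].
rewrite /= ImE_sum /cexpi /=; apply/cvg_lim => //.
under eq_cvg do rewrite E ImE_sum /=.
apply: cvg_sum_seq => i; apply: cvgD; apply: cvgMl; [exact: cc|exact: cs].
Qed.

Lemma cexpiM (x : R) k : cexpi x ^+ k = cexpi (x *+ k).
Proof.
elim: k => [|k IH]; first by rewrite expr0 mulr0n /cexpi cos0 sin0.
rewrite exprS IH mulrS /cexpi cosD sinD; apply/eqP; rewrite eq_complex /=.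
by apply/andP; split; apply/eqP; ring.
Qed.

Lemma cexpi_conjM (x : R) : conjc (cexpi x) * cexpi x = 1.
Proof.
rewrite /cexpi; apply/eqP; rewrite eq_complex /=; apply/andP.
split; apply/eqP; last by ring.
by rewrite mulNr opprK -!expr2 cos2Dsin2.
Qed.

Lemma conjc_cexpi (x : R) : conjc (cexpi x) = cexpi (- x).
Proof. by rewrite /cexpi cosN sinN. Qed.

End Exponential.

(** * Tensor products and composition of protocols *)

Section Tensor.
Variable K : comNzRingType.

Lemma tensmxDl m n p q (A B : 'M[K]_(m, n)) (D : 'M[K]_(p, q)) :
  (A + B) *t D = A *t D + B *t D.
Proof. by apply/matrixP => i j; rewrite !mxE mulrDl. Qed.

Lemma tensmxDr m n p q (A : 'M[K]_(m, n)) (B D : 'M[K]_(p, q)) :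
  A *t (B + D) = A *t B + A *t D.
Proof. by apply/matrixP => i j; rewrite !mxE mulrDr. Qed.

Lemma tensmxZl m n p q a (A : 'M[K]_(m, n)) (D : 'M[K]_(p, q)) :
  (a *: A) *t D = a *: (A *t D).
Proof. by apply/matrixP => i j; rewrite !mxE mulrA. Qed.

Lemma tensmxZr m n p q a (A : 'M[K]_(m, n)) (D : 'M[K]_(p, q)) :
  A *t (a *: D) = a *: (A *t D).
Proof. by apply/matrixP => i j; rewrite !mxE mulrCA. Qed.

Lemma tensmxNl m n p q (A : 'M[K]_(m, n)) (D : 'M[K]_(p, q)) :
  (- A) *t D = - (A *t D).
Proof. by apply/matrixP => i j; rewrite !mxE mulNr. Qed.

Lemma tensmx_suml m n p q I (s : seq I) (F : I -> 'M[K]_(m, n)) (D : 'M[K]_(p, q)) :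
  (\sum_(i <- s) F i) *t D = \sum_(i <- s) F i *t D.
Proof.
elim: s => [|i s IH]; first by rewrite !big_nil tens0mx.
by rewrite !big_cons tensmxDl IH.
Qed.

Lemma tensmx_sumr m n p q I (s : seq I) (A : 'M[K]_(m, n)) (F : I -> 'M[K]_(p, q)) :
  A *t (\sum_(i <- s) F i) = \sum_(i <- s) A *t F i.
Proof.
elim: s => [|i s IH]; first by rewrite !big_nil tensmx0.
by rewrite !big_cons tensmxDr IH.
Qed.

Lemma tensmx11 m n : (1%:M : 'M[K]_m) *t (1%:M : 'M[K]_n) = 1%:M.
Proof.
apply/matrixP => i j; rewrite !mxE.
case: (mxtens_indexP i) => i0 i1; case: (mxtens_indexP j) => j0 j1.
rewrite !mxtens_indexK /= (can_eq (@mxtens_indexK _ _)) xpair_eqE.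
by case: eqP; case: eqP => _ _ //=; rewrite ?mulr1n ?mulr0n ?mulr0 ?mul0r ?mulr1.
Qed.

Lemma tensmxA m n p m' n' p' (A : 'M[K]_(m, m')) (B : 'M[K]_(n, n'))
    (D : 'M[K]_(p, p')) :
  A *t (B *t D) = castmx (esym (mulnA m n p), esym (mulnA m' n' p')) (A *t B *t D).
Proof.
apply/matrixP => i j; rewrite castmxE !esymK.
case: (mxtens_indexP i) => i0 i'; case: (mxtens_indexP i') => i1 i2.
case: (mxtens_indexP j) => j0 j'; case: (mxtens_indexP j') => j1 j2.
have E a b c (x : 'I_a) (y : 'I_b) (z : 'I_c) :
    cast_ord (mulnA a b c) (mxtens_index (x, mxtens_index (y, z))) =
    mxtens_index (mxtens_index (x, y), z).
  by apply: val_inj; rewrite /= mulnDl mulnA addnA.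
by rewrite !E !tensmxE mulrA.
Qed.

Lemma mxtrace_tens m n (A : 'M[K]_m) (B : 'M[K]_n) : \tr (A *t B) = \tr A * \tr B.
Proof. by rewrite /mxtrace mulr_sum; apply: eq_bigr => i _; rewrite mxE. Qed.

Definition mxblk m n (s : 'M[K]_(m * n)) b b' : 'M[K]_m :=
  \matrix_(a, a') s (mxtens_index (a, b)) (mxtens_index (a', b')).

Lemma mxblk_decomp m n (s : 'M[K]_(m * n)) :
  s = \sum_b \sum_b' mxblk s b b' *t delta_mx b b'.
Proof.
apply/matrixP => i j.
case: (mxtens_indexP i) => i0 i1; case: (mxtens_indexP j) => j0 j1.
rewrite summxE (bigD1 i1) //= summxE (bigD1 j1) //= tensmxE !mxE !eqxx mulr1.
rewrite !big1 ?addr0 // => b hb.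
  rewrite summxE big1 // => b' _.
  by rewrite tensmxE !mxE eq_sym (negbTE hb) mulr0.
by rewrite tensmxE !mxE [j1 == _]eq_sym (negbTE hb) andbF mulr0.
Qed.

(** Cutting a matrix into blocks writes it as a sum of products [mxblk _ b b' *t delta_mx b b'].
    Additivity is enough because the scalars are absorbed in the blocks. *)
Lemma tens_additive_ext m n (W : zmodType) (F G : 'M[K]_(m * n) -> W) :
  {morph F : x y / x + y} -> {morph G : x y / x + y} ->
  (forall M N, F (M *t N) = G (M *t N)) -> F =1 G.
Proof.
move=> aF aG FG s.
have F0 : F 0 = 0 by apply: (addrI (F 0)); rewrite -aF !addr0.
have G0 : G 0 = 0 by apply: (addrI (G 0)); rewrite -aG !addr0.
rewrite [s]mxblk_decomp !(big_morph F aF F0) !(big_morph G aG G0).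
apply: eq_bigr => b _; rewrite (big_morph F aF F0) (big_morph G aG G0).
by apply: eq_bigr => b' _; apply: FG.
Qed.

Lemma castmx_conj m n n' p (e : n = n') (A : 'M[K]_(m, n)) (B : 'M[K]_n)
    (D : 'M[K]_(n, p)) :
  castmx (erefl m, e) A *m castmx (e, e) B *m castmx (e, erefl p) D = A *m B *m D.
Proof. by case: n' / e. Qed.

Lemma castmx_gram m n n' (e : n = n') (A : 'M[K]_(n, m)) (B : 'M[K]_(m, n)) :
  castmx (e, erefl m) A *m castmx (erefl m, e) B = castmx (e, e) (A *m B).
Proof. by case: n' / e. Qed.

Lemma castmx_sum m n m' n' (e1 : m = m') (e2 : n = n') I (s : seq I)
    (F : I -> 'M[K]_(m, n)) :
  castmx (e1, e2) (\sum_(i <- s) F i) = \sum_(i <- s) castmx (e1, e2) (F i).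
Proof. by case: m' / e1; case: n' / e2. Qed.

Lemma castmx1 n n' (e : n = n') : castmx (e, e) (1%:M : 'M[K]_n) = 1%:M.
Proof. by case: n' / e. Qed.

Lemma mxtrace_cast n n' (e : n = n') (A : 'M[K]_n) : \tr (castmx (e, e) A) = \tr A.
Proof. by case: n' / e. Qed.

Lemma tensmx_castr m n n' (e : n = n') (e2 : (m * n = m * n')%N)
    (A : 'M[K]_m) (B : 'M[K]_n) :
  A *t castmx (e, e) B = castmx (e2, e2) (A *t B).
Proof. by case: n' / e e2 => e2; rewrite !castmx_id. Qed.

Lemma tensmx_castl m n n' (e : n = n') (e2 : (n * m = n' * m)%N)
    (A : 'M[K]_m) (B : 'M[K]_n) :
  castmx (e, e) B *t A = castmx (e2, e2) (B *t A).
Proof. by case: n' / e e2 => e2; rewrite !castmx_id. Qed.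

Lemma castmx_irr m n m' n' (e1 f1 : m = m') (e2 f2 : n = n') (A : 'M[K]_(m, n)) :
  castmx (e1, e2) A = castmx (f1, f2) A.
Proof. by rewrite (eq_irrelevance e1 f1) (eq_irrelevance e2 f2). Qed.

End Tensor.

Lemma In_map T U (f : T -> U) (s : seq T) x :
  List.In x (map f s) -> exists2 y, List.In y s & x = f y.
Proof.
elim: s => [//|y s IH] /= [<-|/IH[z hz ->]]; first by exists y; [left|].
by exists z; [right|].
Qed.

Lemma In_allpairs T1 T2 T (f : T1 -> T2 -> T) s s' x :
  List.In x [seq f a b | a <- s, b <- s'] ->
  exists a b, [/\ List.In a s, List.In b s' & x = f a b].
Proof.
have InC (u v : seq T) : List.In x (u ++ v) -> List.In x u \/ List.In x v.
  by elim: u => [|y u IH] /=; [right|case=> [|/IH[]]; tauto].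
elim: s => [//|a s IH]; rewrite allpairs_cons => /InC[hx|/IH[a' [b [h1 h2 ->]]]].
  have [b hb ->] := In_map hx.
  by exists a, b; split=> //; left.
by exists a', b; split=> //; right.
Qed.

Lemma leq_bigmax_In T (s : seq T) (F : T -> nat) x :
  List.In x s -> (F x <= \max_(y <- s) F y)%N.
Proof.
elim: s => [//|y s IH]; rewrite big_cons => -[->|/IH hx]; first exact: leq_maxl.
exact: leq_trans hx (leq_maxr _ _).
Qed.

Lemma bigmax_leq_In T (s : seq T) (F : T -> nat) m :
  (forall x, List.In x s -> (F x <= m)%N) -> (\max_(x <- s) F x <= m)%N.
Proof.
elim: s => [|x s IH] h; first by rewrite big_nil.
rewrite big_cons geq_max h /=; last by left.
by apply: IH => y hy; apply: h; right.
Qed.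

(** * Branches and protocols as channels, and their composition *)

Section Branches.
Variables (R : realType) (K dA : nat).
Local Notation C := (complex R).
Implicit Types (rho : 'I_K -> 'M[C]_dA) (b : branch R K dA) (P : protocol R K dA).

Lemma samples_state_cat rho s s'
    (e : (dA ^ size s * dA ^ size s' = dA ^ size (s ++ s'))%N) :
  samples_state rho (s ++ s') =
  castmx (e, e) (samples_state rho s *t samples_state rho s').
Proof.
elim: s e => [|j s IH] e /=.
  by rewrite -[1%:M]/(1 : 'M[C]_1) tens_scalar1mx castmx_comp castmx_id.
have e1 : (dA ^ size s * dA ^ size s' = dA ^ size (s ++ s'))%N.
  by rewrite size_cat expnD.
have e2 : (dA * (dA ^ size s * dA ^ size s') = dA * dA ^ size (s ++ s'))%N.
  by rewrite e1.
have e3 : (dA * dA ^ size s * dA ^ size s' = dA ^ (size s).+1 * dA ^ size s')%N.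
  by rewrite expnS.
rewrite (IH e1) (tensmx_castr e1 e2) (tensmx_castl _ e3) tensmxA !castmx_comp.
exact: castmx_irr.
Qed.

Lemma samples_state_density rho s :
  (forall j, density (rho j)) -> density (samples_state rho s).
Proof.
move=> hr; elim: s => [|j s [IH1 IH2]] /=.
  split; last by rewrite mxtrace1.
  by have := psdmx_gram (1%:M : 'M[C]_(dA ^ 0)); rewrite adjmx1 mul1mx.
have [r1 r2] := hr j.
split; last by rewrite mxtrace_cast mxtrace_tens r2 IH2 mulr1.
have := psdmx_tens r1 IH1; move: (rho j *t _) => X.
by move: (esym _); case: _ /.
Qed.

(** The channel on [A] alone; [branch_out] is its tensor product with the identity channel on
    [B]. *)
Definition branch_map rho b (M : 'M[C]_dA) : 'M[C]_dA :=
  \sum_(E <- br_kraus b) E *m (samples_state rho (br_seq b) *t M) *m E^†.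

Lemma branch_out_tens rho b dB (M : 'M[C]_dA) (N : 'M[C]_dB) :
  branch_out rho b (M *t N) = branch_map rho b M *t N.
Proof.
rewrite /branch_out /branch_map tensmx_suml; apply: eq_bigr => E _.
rewrite tensmxA adjmx_cast castmx_conj adjmx_tens adjmx1 !tensmx_mul.
by rewrite mul1mx mulmx1.
Qed.

Lemma branch_outD rho b dB : {morph @branch_out R K dA dB rho b : x y / x + y}.
Proof.
move=> x y; rewrite /branch_out -big_split; apply: eq_bigr => E _.
by rewrite tensmxDr mulmxDr mulmxDl.
Qed.

Lemma branch_outZ rho b dB a (s : 'M[C]_(dA * dB)) :
  branch_out rho b (a *: s) = a *: branch_out rho b s.
Proof.
rewrite /branch_out scaler_sumr; apply: eq_bigr => E _.
by rewrite tensmxZr -scalemxAr -scalemxAl.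
Qed.

Lemma branch_out_sum rho b dB I (r : seq I) (F : I -> 'M[C]_(dA * dB)) :
  branch_out rho b (\sum_(i <- r) F i) = \sum_(i <- r) branch_out rho b (F i).
Proof.
apply: (big_morph _ (branch_outD rho b (dB := dB))).
by have := branch_outZ rho b 0 (0 : 'M[C]_(dA * dB)); rewrite !scale0r.
Qed.

Lemma protocol_outD rho P dB : {morph @protocol_out R K dA dB rho P : x y / x + y}.
Proof.
move=> x y; rewrite /protocol_out -big_split; apply: eq_bigr => p _.
by rewrite branch_outD scalerDr.
Qed.

Lemma protocol_out_tens rho P dB (M : 'M[C]_dA) (N : 'M[C]_dB) :
  protocol_out rho P (M *t N) =
  (\sum_(p <- P) p.1%:RC *: branch_map rho p.2 M) *t N.
Proof.
rewrite /protocol_out tensmx_suml; apply: eq_bigr => p _.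
by rewrite tensmxZl branch_out_tens.
Qed.

(** Each Kraus term is a conjugation of a positive matrix; for the trace, cyclicity gathers the
    Kraus operators into their Gram sum, which is the identity. *)
Lemma branch_out_density rho b dB (s : 'M[C]_(dA * dB)) :
  (forall j, density (rho j)) -> trace_preserving b -> density s ->
  density (branch_out rho b s).
Proof.
move=> hr tp [s1 s2]; have [S1 S2] := samples_state_density (br_seq b) hr.
split.
  apply: psdmx_sum => E _; exact: (psdmx_conj _ (psdmx_tens S1 s1)).
rewrite /branch_out raddf_sum /=.
set X := _ *t s.
set e := esym (mulnA _ dA dB).
transitivity (\tr (\sum_(E <- br_kraus b)
    castmx (e, e) ((E^† *m E) *t (1%:M : 'M[C]_dB)) *m X)).
  rewrite raddf_sum /=; apply: eq_bigr => E _.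
  rewrite mxtrace_mulC mulmxA adjmx_cast castmx_gram adjmx_tens adjmx1.
  by rewrite tensmx_mul mul1mx.
rewrite -mulmx_suml -castmx_sum -tensmx_suml tp tensmx11 castmx1 mul1mx.
by rewrite mxtrace_tens S2 s2 mulr1.
Qed.

Lemma psdmx_sum_In n T (s : seq T) (F : T -> 'M[C]_n) :
  (forall x, List.In x s -> psdmx (F x)) -> psdmx (\sum_(x <- s) F x).
Proof.
elim: s => [|x s IH] h; first by rewrite big_nil; apply: psdmx0.
rewrite big_cons; apply: psdmxD; first by apply: h; left.
by apply: IH => y hy; apply: h; right.
Qed.

Lemma eq_big_In (V : nmodType) T (s : seq T) (F G : T -> V) :
  (forall x, List.In x s -> F x = G x) -> \sum_(x <- s) F x = \sum_(x <- s) G x.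
Proof.
elim: s => [|x s IH] h; first by rewrite !big_nil.
rewrite !big_cons; congr (_ + _); first by apply: h; left.
by apply: IH => y hy; apply: h; right.
Qed.

Lemma protocol_out_density rho P dB (s : 'M[C]_(dA * dB)) :
  (forall j, density (rho j)) -> valid_protocol P -> density s ->
  density (protocol_out rho P s).
Proof.
move=> hr [h1 h2] hs; split.
  apply: psdmx_sum_In => p hp; have [p0 tp] := h1 _ hp.
  by apply: psdmxZ => //; have [] := branch_out_density hr tp hs.
rewrite /protocol_out raddf_sum /=.
rewrite (eq_big_In (G := fun p => p.1%:RC)).
  by rewrite -rmorph_sum /= h2.
move=> p hp; have [p0 tp] := h1 _ hp.
by rewrite linearZ /=; have [_ ->] := branch_out_density hr tp hs; rewrite mulr1.
Qed.

Lemma branch_comp_dim (s s' : seq 'I_K) :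
  (dA ^ size s * (dA ^ size s' * dA) = dA ^ size (s ++ s') * dA)%N.
Proof. by rewrite size_cat expnD mulnA. Qed.

(** The branch [b'] acts first, yet its samples come last: they are then adjacent to the system, and
    [1%:M *t E'] consumes them while leaving those of [b] for [E]. *)
Definition branch_comp b b' : branch R K dA :=
  Branch (br_seq := br_seq b ++ br_seq b')
    [seq castmx (erefl dA, branch_comp_dim _ _) (E *m (1%:M *t E'))
      | E <- br_kraus b, E' <- br_kraus b'].

Lemma branch_map_comp rho b b' M :
  branch_map rho (branch_comp b b') M = branch_map rho b (branch_map rho b' M).
Proof.
rewrite /branch_map /= big_allpairs_dep; apply: eq_bigr => E _.
rewrite tensmx_sumr mulmx_sumr mulmx_suml; apply: eq_bigr => E' _.
have e1 : (dA ^ size (br_seq b) * dA ^ size (br_seq b') =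
          dA ^ size (br_seq b ++ br_seq b'))%N by rewrite size_cat expnD.
have e2 : (dA ^ size (br_seq b) * dA ^ size (br_seq b') * dA =
          dA ^ size (br_seq b ++ br_seq b') * dA)%N by rewrite e1.
have -> : samples_state rho (br_seq b ++ br_seq b') *t M =
   castmx (branch_comp_dim _ _, branch_comp_dim _ _)
    (samples_state rho (br_seq b) *t (samples_state rho (br_seq b') *t M)).
  rewrite (samples_state_cat rho e1) (tensmx_castl e1 e2) tensmxA castmx_comp.
  exact: castmx_irr.
rewrite adjmx_cast castmx_conj adjmxM adjmx_tens adjmx1.
rewrite !mulmxA; congr (_ *m _); rewrite -!mulmxA; congr (_ *m _).
by rewrite !tensmx_mul mul1mx mulmx1 mulmxA.
Qed.

Lemma branch_out_comp rho b b' dB (s : 'M[C]_(dA * dB)) :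
  branch_out rho (branch_comp b b') s = branch_out rho b (branch_out rho b' s).
Proof.
apply: (tens_additive_ext (F := branch_out rho (branch_comp b b'))
   (G := fun s => branch_out rho b (branch_out rho b' s))).
- exact: branch_outD.
- by move=> x y; rewrite !branch_outD.
- by move=> M N; rewrite !branch_out_tens branch_map_comp.
Qed.

Lemma branch_comp_tp b b' :
  trace_preserving b -> trace_preserving b' -> trace_preserving (branch_comp b b').
Proof.
rewrite /trace_preserving => tb tb'; rewrite /= big_allpairs_dep exchange_big /=.
set e := branch_comp_dim (br_seq b) (br_seq b').
rewrite -[RHS](castmx1 _ e).
transitivity (\sum_(E' <- br_kraus b') castmx (e, e) (1%:M *t (E'^† *m E'))).
  apply: eq_bigr => E' _.
  transitivity (castmx (e, e)
      ((1%:M *t E'^†) *m (\sum_(E <- br_kraus b) E^† *m E) *m (1%:M *t E'))).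
    rewrite mulmx_sumr mulmx_suml castmx_sum; apply: eq_bigr => E _.
    by rewrite adjmx_cast castmx_gram adjmxM adjmx_tens adjmx1 !mulmxA.
  by rewrite tb mulmx1 tensmx_mul mul1mx.
by rewrite -castmx_sum -tensmx_sumr tb' tensmx11.
Qed.

Definition protocol_comp P P' : protocol R K dA :=
  [seq (p.1 * p'.1, branch_comp p.2 p'.2) | p <- P, p' <- P'].

Lemma protocol_comp_valid P P' :
  valid_protocol P -> valid_protocol P' -> valid_protocol (protocol_comp P P').
Proof.
move=> [v1 v2] [w1 w2]; split.
  rewrite /protocol_comp => pb hpb.
  have [p [p' [/v1[h1 h2] /w1[h3 h4] ->]]] := In_allpairs hpb.
  by split; [exact: mulr_ge0|exact: branch_comp_tp].
rewrite big_allpairs_dep /=; under eq_bigr do rewrite -mulr_sumr w2 mulr1.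
exact: v2.
Qed.

Lemma protocol_out_comp rho P P' dB (s : 'M[C]_(dA * dB)) :
  protocol_out rho (protocol_comp P P') s = protocol_out rho P (protocol_out rho P' s).
Proof.
rewrite /protocol_out big_allpairs_dep; apply: eq_bigr => p _.
rewrite branch_out_sum scaler_sumr; apply: eq_bigr => p' _.
by rewrite branch_outZ scalerA -rmorphM branch_out_comp.
Qed.

Lemma protocol_comp_max P P' :
  (max_samples (protocol_comp P P') <= max_samples P + max_samples P')%N.
Proof.
rewrite {1}/max_samples /protocol_comp big_allpairs_dep.
apply: bigmax_leq_In => p hp; apply: bigmax_leq_In => p' hp' /=.
rewrite size_cat; apply: leq_add.
  exact: (leq_bigmax_In (fun p : R * branch R K dA => size (br_seq p.2)) hp).
exact: (leq_bigmax_In (fun p : R * branch R K dA => size (br_seq p.2)) hp').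
Qed.

(** The two branches are drawn independently and counts add over concatenation; since each family of
    weights sums to 1, the other factor marginalises out. *)
Lemma protocol_comp_copies P P' j : valid_protocol P -> valid_protocol P' ->
  expected_copies (protocol_comp P P') j = expected_copies P j + expected_copies P' j.
Proof.
move=> [_ p1] [_ p1']; rewrite /expected_copies /protocol_comp big_allpairs_dep /=.
under eq_bigr => p _.
  under eq_bigr => p' _ do rewrite /vcount count_cat natrD mulrDr
    -[p.1 * p'.1 * (count (pred1 j) (br_seq p'.2))%:R]mulrA
    [p.1 * p'.1]mulrC -mulrA.
  rewrite big_split -mulr_suml p1' mul1r -mulr_sumr; over.
by rewrite big_split -mulr_suml p1 mul1r.
Qed.

End Branches.

(** * One random step of the protocol *)

Section PartialTrace.
Variables (R : realType) (d : nat).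
Local Notation C := (complex R).

Definition ptr D (X : 'M[C]_(D * d)) : 'M[C]_d :=
  \matrix_(a, a') \sum_x X (mxtens_index (x, a)) (mxtens_index (x, a')).

Lemma ptrD D (X Y : 'M[C]_(D * d)) : ptr (X + Y) = ptr X + ptr Y.
Proof.
apply/matrixP => a a'; rewrite !mxE -big_split.
by apply: eq_bigr => x _; rewrite mxE.
Qed.

Lemma ptrZ D k (X : 'M[C]_(D * d)) : ptr (k *: X) = k *: ptr X.
Proof.
by apply/matrixP => a a'; rewrite !mxE mulr_sumr; apply: eq_bigr => x _; rewrite mxE.
Qed.

Lemma ptrN D (X : 'M[C]_(D * d)) : ptr (- X) = - ptr X.
Proof. by rewrite -scaleN1r ptrZ scaleN1r. Qed.

Lemma ptr_adj D (X : 'M[C]_(D * d)) : ptr X^† = (ptr X)^†.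
Proof.
apply/matrixP => a a'; rewrite !mxE rmorph_sum.
by apply: eq_bigr => x _; rewrite !mxE.
Qed.

Lemma ptr_tens D (S : 'M[C]_D) (M : 'M[C]_d) : ptr (S *t M) = \tr S *: M.
Proof.
apply/matrixP => a a'; rewrite !mxE mulr_suml.
by apply: eq_bigr => x _; rewrite tensmxE.
Qed.

(** The operator [<x|] on the samples tensored with the identity of the system; the family over [x]
    gives Kraus operators of the partial trace. *)
Definition bra D (x : 'I_D) : 'M[C]_(d, D * d) :=
  \matrix_(a, i) (i == mxtens_index (x, a))%:R.

Lemma bra_adjE D (x : 'I_D) i a : (bra x)^† i a = (i == mxtens_index (x, a))%:R.
Proof. by rewrite !mxE; case: eqP => _; rewrite ?conjc1 ?conjc0. Qed.

Lemma sum_delta m (i : 'I_m) (F : 'I_m -> C) : \sum_j (j == i)%:R * F j = F i.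
Proof.
rewrite (bigD1 i) //= eqxx mul1r big1 ?addr0 // => j /negbTE ->.
by rewrite mul0r.
Qed.

Lemma bra_ptr D (X : 'M[C]_(D * d)) : \sum_x bra x *m X *m (bra x)^† = ptr X.
Proof.
apply/matrixP => a a'; rewrite summxE mxE; apply: eq_bigr => x _.
rewrite mxE; under eq_bigr => j _ do rewrite bra_adjE mulrC.
rewrite sum_delta mxE; under eq_bigr => j _ do rewrite mxE.
by rewrite sum_delta.
Qed.

Lemma sum_mxtens m n (F : 'I_(m * n) -> C) :
  \sum_i F i = \sum_x \sum_a F (mxtens_index (x, a)).
Proof.
rewrite pair_big /= (reindex (@mxtens_index m n)) /=; last first.
  by exists (@mxtens_unindex m n) => i _; rewrite ?mxtens_indexK ?mxtens_unindexK.
by apply: eq_bigr => -[].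
Qed.

Lemma bra_gram D : \sum_(x < D) (bra x)^† *m bra x = 1%:M.
Proof.
apply/matrixP => i j; rewrite summxE mxE.
under eq_bigr => x _ do rewrite mxE.
under eq_bigr => x _.
  under eq_bigr => a _ do rewrite bra_adjE mxE.
  over.
rewrite -(sum_mxtens (fun k => (i == k)%:R * (j == k)%:R)) /=.
under eq_bigr => k _ do rewrite eq_sym.
by rewrite sum_delta eq_sym.
Qed.

(** Exchanges the first sample with the system, across the remaining samples of joint dimension
    [D]. *)
Definition swap_index D (i : 'I_(d * (D * d))) : 'I_(d * (D * d)) :=
  let k := (mxtens_unindex i).1 in
  let x := (mxtens_unindex (mxtens_unindex i).2).1 in
  let a := (mxtens_unindex (mxtens_unindex i).2).2 in
  mxtens_index (a, mxtens_index (x, k)).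

Lemma swap_indexE D k (x : 'I_D) a :
  swap_index (mxtens_index (k, mxtens_index (x, a))) =
  mxtens_index (a, mxtens_index (x, k)).
Proof. by rewrite /swap_index !mxtens_indexK. Qed.

Lemma swap_indexK D : involutive (@swap_index D).
Proof.
move=> i; case: (mxtens_indexP i) => k i'; case: (mxtens_indexP i') => x a.
by rewrite !swap_indexE.
Qed.

Definition swapmx D : 'M[C]_(d * (D * d)) := \matrix_(i, j) (j == swap_index i)%:R.

Lemma swapmxM D n (X : 'M[C]_(_, n)) i j : (swapmx D *m X) i j = X (swap_index i) j.
Proof. by rewrite mxE; under eq_bigr => k _ do rewrite mxE; rewrite sum_delta. Qed.

Lemma swapmx_adj D : (swapmx D)^† = swapmx D.
Proof.
apply/matrixP => i j; rewrite !mxE -(inv_eq (@swap_indexK D)) eq_sym.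
by case: eqP => _; rewrite ?conjc1 ?conjc0.
Qed.

Lemma swapmx_sqr D : swapmx D *m swapmx D = 1%:M.
Proof. by apply/matrixP => i j; rewrite swapmxM !mxE swap_indexK eq_sym. Qed.

Lemma ptr_cast D (e : (d * (D * d) = d * D * d)%N) (X : 'M[C]_(d * (D * d))) a a' :
  ptr (castmx (e, e) X) a a' =
  \sum_k \sum_x X (mxtens_index (k, mxtens_index (x, a)))
                  (mxtens_index (k, mxtens_index (x, a'))).
Proof.
rewrite mxE sum_mxtens; apply: eq_bigr => k _; apply: eq_bigr => x _.
rewrite castmxE; congr (X _ _); apply: val_inj => /=; ring.
Qed.

(** The swap moves the traced index [k] of the sample into the system slot, so the trace sums
    [rho a k] against the rows of [ptr Z]: this is matrix multiplication. *)
Lemma ptr_swap D (rho : 'M[C]_d) (Z : 'M[C]_(D * d))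
    (e : (d * (D * d) = d * D * d)%N) :
  ptr (castmx (e, e) (swapmx D *m (rho *t Z))) = rho *m ptr Z.
Proof.
apply/matrixP => a a'; rewrite ptr_cast mxE; apply: eq_bigr => k _.
rewrite mxE mulr_sumr; apply: eq_bigr => x _.
by rewrite swapmxM swap_indexE tensmxE.
Qed.

(** Here the swap comes before [V], so [rho] multiplies [M] before the rest of the word does; this
    is the origin of the reversed order. *)
Lemma ptr_swap_adj D (rho M : 'M[C]_d) (V : 'M[C]_(D * d)) (S : 'M[C]_D)
    (e : (d * (D * d) = d * D * d)%N) :
  ptr (castmx (e, e) ((1%:M *t V) *m swapmx D *m (rho *t (S *t M)))) =
  ptr (V *m (S *t (rho *m M))).
Proof.
apply/matrixP => a a'; rewrite ptr_cast mxE exchange_big /=.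
apply: eq_bigr => x _; rewrite mxE.
under eq_bigr => k _.
  (* [1%:M *t V] is block diagonal in the first sample, so only the block [k' = k] survives. *)
  rewrite -mulmxA mxE sum_mxtens (bigD1 k) //= [X in _ + X]big1 ?addr0; last first.
    move=> k' hk; rewrite big1 // => i _.
    by rewrite tensmxE mxE eq_sym (negbTE hk) !mul0r.
  under eq_bigr => i _ do rewrite tensmxE mxE eqxx mul1r swapmxM.
  over.
rewrite exchange_big /= !(sum_mxtens (m := D)).
apply: eq_bigr => x' _; apply: eq_bigr => b _.
under eq_bigr => k _ do rewrite swap_indexE tensmxE tensmxE.
rewrite tensmxE mxE !mulr_sumr; apply: eq_bigr => k _.
ring.
Qed.

End PartialTrace.

(** * Cyclic shift and the Kraus pair *)

Section Step.
Variables (R : realType) (K dA : nat).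
Local Notation C := (complex R).
Implicit Types (rho : 'I_K -> 'M[C]_dA).

Lemma word_prod_adj rho s : (forall j, (rho j)^† = rho j) ->
  (word_prod rho s)^† = word_prod rho (rev s).
Proof.
move=> h; elim: s => [|j s IH]; rewrite /word_prod; first by rewrite !big_nil adjmx1.
rewrite rev_cons big_cons -[_ * _]/(_ *m _) adjmxM h -cats1 big_cat big_seq1 /=.
by rewrite -[_ * _]/(_ *m _); congr (_ *m _).
Qed.

(* [W] first shifts the tail of the word, then swaps [A] with the first sample. *)
Lemma shift_exists (s : seq 'I_K) :
  exists W : 'M[C]_(dA ^ size s * dA),
  [/\ W^† *m W = 1%:M, W *m W^† = 1%:M &
    forall rho M, ptr (W *m (samples_state rho s *t M)) = word_prod rho s *m M /\
      ptr (W^† *m (samples_state rho s *t M)) = word_prod rho (rev s) *m M].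
Proof.
elim: s => [|j s [W [W1 W2 hW]]].
  exists 1%:M; rewrite adjmx1 mul1mx; split=> // rho M; rewrite mul1mx.
  by rewrite /word_prod !big_nil /= ptr_tens mxtrace1 scale1r -[1 in RHS]/(1%:M) mul1mx.
have e : (dA * (dA ^ size s * dA) = dA ^ size (j :: s) * dA)%N.
  by rewrite /= expnS mulnA.
have e' : (dA * (dA ^ size s * dA) = dA * dA ^ size s * dA)%N by rewrite mulnA.
have e2 : (dA * dA ^ size s * dA = dA ^ size (j :: s) * dA)%N.
  by rewrite /= expnS.
pose V := swapmx R dA (dA ^ size s) *m (1%:M *t W).
have cM (X Y : 'M[C]_(dA * (dA ^ size s * dA))) :
    castmx (e, e) X *m castmx (e, e) Y = castmx (e, e) (X *m Y).
  by case: _ / e.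
(* The partial trace does not depend on which of two equal expressions denotes the dimension of the
   samples. *)
have cp (X : 'M[C]_(dA * (dA ^ size s * dA))) :
    ptr (castmx (e, e) X) = ptr (castmx (e', e') X).
  have -> : castmx (e, e) X = castmx (e2, e2) (castmx (e', e') X).
    by rewrite castmx_comp; apply: castmx_irr.
  have ex : (dA * dA ^ size s = dA ^ size (j :: s))%N by rewrite /= expnS.
  move: (castmx (e', e') X) e2; case: _ / ex => Z e3.
  by rewrite castmx_id.
have VE : V^† = (1%:M *t W^†) *m swapmx R dA (dA ^ size s).
  by rewrite /V adjmxM swapmx_adj adjmx_tens adjmx1.
exists (castmx (e, e) V); rewrite adjmx_cast !cM; split.
- rewrite VE /V mulmxA -[_ *m swapmx _ _ _ *m swapmx _ _ _]mulmxA swapmx_sqr mulmx1.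
  by rewrite tensmx_mul mul1mx W1 tensmx11 castmx1.
- rewrite VE /V mulmxA -[_ *m (1%:M *t W) *m _]mulmxA tensmx_mul mul1mx W2 tensmx11.
  by rewrite mulmx1 swapmx_sqr castmx1.
move=> rho M.
have -> : samples_state rho (j :: s) *t M =
    castmx (e, e) (rho j *t (samples_state rho s *t M)).
  by rewrite /= (tensmx_castl _ e2) tensmxA castmx_comp; apply: castmx_irr.
rewrite !cM !cp; split.
  rewrite /V -mulmxA tensmx_mul mul1mx ptr_swap; have [-> _] := hW rho M.
  by rewrite /word_prod big_cons -[_ * _]/(_ *m _) mulmxA.
rewrite VE ptr_swap_adj; have [_ ->] := hW rho (rho j *m M).
rewrite rev_cons /word_prod -cats1 big_cat big_seq1 /=.
by rewrite -[_ * _]/(_ *m _) mulmxA.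
Qed.

(** Composing every Kraus operator with every [bra x] amounts to applying the channel and then
    discarding the samples. *)
Definition traced_branch (s : seq 'I_K) (Es : seq 'M[C]_(dA ^ size s * dA)) :
    branch R K dA :=
  Branch (br_seq := s) [seq bra R dA x *m E | E <- Es, x <- index_enum 'I_(dA ^ size s)].

Lemma traced_branch_tp s (Es : seq 'M[C]_(dA ^ size s * dA)) :
  \sum_(E <- Es) E^† *m E = 1%:M -> trace_preserving (traced_branch Es).
Proof.
move=> h; rewrite /trace_preserving /= big_allpairs_dep -h; apply: eq_bigr => E _.
under eq_bigr => x _ do rewrite adjmxM mulmxA -[_ *m _ *m bra _ _ _]mulmxA.
by rewrite -mulmx_suml -mulmx_sumr bra_gram mulmx1.
Qed.

Lemma traced_branch_map rho s (Es : seq 'M[C]_(dA ^ size s * dA)) M :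
  branch_map rho (traced_branch Es) M =
  \sum_(E <- Es) ptr (E *m (samples_state rho s *t M) *m E^†).
Proof.
rewrite /branch_map /= big_allpairs_dep; apply: eq_bigr => E _.
rewrite -bra_ptr; apply: eq_bigr => x _.
by rewrite adjmxM !mulmxA.
Qed.

Lemma Hterm_herm rho phi s : (forall j, (rho j)^† = rho j) ->
  (Hterm rho phi s)^† = Hterm rho phi s.
Proof.
move=> h; rewrite /Hterm adjmxZ conjc_inv conjc_nat; congr (_ *: _).
rewrite adjmxD 2!adjmxZ (word_prod_adj _ h) (word_prod_adj (rev s) h) revK.
by rewrite 2!conjc_cexpi opprK addrC.
Qed.

(* The second summand cancels the terms [A X A] and [A^† X A^†] of the first. *)
Lemma kraus_pair n (A X : 'M[C]_n) (z : C) : z * z = -1 ->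
  let G := A + A^† in
  (1%:M - z *: G) *m X *m (1%:M + z *: G) + (A - A^†) *m X *m (A^† - A) =
  X - z *: (G *m X - X *m G) + 2%:R *: (A *m X *m A^† + A^† *m X *m A).
Proof.
move=> zz /=; move: (A^†) => B.
rewrite !(mulmxDl, mulmxDr, mulmxN, mulNmx, mul1mx, mulmx1).
rewrite -!(scalemxAl, scalemxAr).
rewrite !(mulmxDl, mulmxDr, mulmxN, mulNmx, mul1mx, mulmx1).
rewrite !(scalerDr, scalerN, scalerA) zz.
move: (A *m X *m A) (A *m X *m B) (B *m X *m A) (B *m X *m B) => x1 x2 x3 x4.
move: (A *m X) (B *m X) (X *m A) (X *m B) => y1 y2 y3 y4.
by apply/matrixP => i j; rewrite !mxE; ring.
Qed.

(** The first product is [1 + G^2]; the squares of [A] and [A^†] in it cancel against the second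
    product, and the mixed terms contribute [2 k] twice. With [k = th^2 / 4] this is the
    normalisation [1 + th^2]. *)
Lemma kraus_pair_gram n (A : 'M[C]_n) (z : C) (k : R) : z * z = -1 ->
  A^† *m A = k%:RC%:M -> A *m A^† = k%:RC%:M ->
  let G := A + A^† in
  (1%:M + z *: G) *m (1%:M - z *: G) + (A^† - A) *m (A - A^†) =
  (1 + 4%:R * k%:RC)%:M.
Proof.
move=> zz h1 h2 /=; move: (A^†) h1 h2 => B h1 h2.
rewrite !(mulmxDl, mulmxDr, mulmxN, mulNmx, mul1mx, mulmx1).
rewrite -!(scalemxAl, scalemxAr).
rewrite !(mulmxDl, mulmxDr, mulmxN, mulNmx, mul1mx, mulmx1).
rewrite !(scalerDr, scalerN, scalerA) zz h1 h2.
move: (A *m A) (B *m B) => x1 x2; rewrite -scalemx1 -[in RHS]scalemx1.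
by apply/matrixP => i j; rewrite !mxE; ring.
Qed.

End Step.
Section StepBranch.
Variables (R : realType) (K dA : nat).
Local Notation C := (complex R).
Implicit Types (rho : 'I_K -> 'M[C]_dA).

Lemma traced_branch_map2 rho s (E F : 'M[C]_(dA ^ size s * dA)) M :
  branch_map rho (traced_branch [:: E; F]) M =
  ptr (E *m (samples_state rho s *t M) *m E^†) +
  ptr (F *m (samples_state rho s *t M) *m F^†).
Proof. by rewrite traced_branch_map !big_cons big_nil addr0. Qed.

Lemma traced_branch_tp2 (s : seq 'I_K) (E F : 'M[C]_(dA ^ size s * dA)) :
  E^† *m E + F^† *m F = 1%:M -> trace_preserving (traced_branch [:: E; F]).
Proof. by move=> h; apply: traced_branch_tp; rewrite !big_cons big_nil addr0. Qed.

Lemma kraus1_adj n (A : 'M[C]_n) (nu : R) (z : C) : conjc z = - z ->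
  (nu%:RC *: (1%:M - z *: (A + A^†)))^† = nu%:RC *: (1%:M + z *: (A + A^†)).
Proof.
move=> cz; rewrite adjmxZR adjmxB adjmxZ adjmx1 cz scaleNr opprK adjmxD adjmxK.
by rewrite (addrC A).
Qed.

Lemma kraus2_adj n (A : 'M[C]_n) (nu : R) :
  (nu%:RC *: (A - A^†))^† = nu%:RC *: (A^† - A).
Proof. by rewrite adjmxZR adjmxB adjmxK. Qed.

Lemma conj_scaled n (nu : R) (E X F : 'M[C]_n) :
  (nu%:RC *: E) *m X *m (nu%:RC *: F) = (nu%:RC * nu%:RC) *: (E *m X *m F).
Proof. by rewrite -!scalemxAl -scalemxAr scalerA. Qed.

Lemma gram_scaled n (nu : R) (E F : 'M[C]_n) :
  (nu%:RC *: E) *m (nu%:RC *: F) = (nu%:RC * nu%:RC) *: (E *m F).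
Proof. by rewrite -!scalemxAl -scalemxAr scalerA. Qed.

Lemma step_map rho s (A : 'M[C]_(dA ^ size s * dA)) (H M : 'M[C]_dA) (nu : R) (z : C) :
  z * z = -1 -> conjc z = - z -> (forall j, density (rho j)) -> H^† = H ->
  (forall N, ptr ((A + A^†) *m (samples_state rho s *t N)) = H *m N) ->
  branch_map rho (traced_branch [:: nu%:RC *: (1%:M - z *: (A + A^†));
                                    nu%:RC *: (A - A^†)]) M =
  (nu%:RC * nu%:RC) *: (M - z *: (H *m M - M *m H) +
    2%:R *: ptr (A *m (samples_state rho s *t M) *m A^† +
                 A^† *m (samples_state rho s *t M) *m A)).
Proof.
move=> zz cz hr hH pG.
have [[hS _] tS] := samples_state_density s hr.
(* Multiplication on the right follows from the left-hand hypothesis by adjunction, the samples, [H]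
   and [A + A^†] being Hermitian. *)
have pG' : ptr ((samples_state rho s *t M) *m (A + A^†)) = M *m H.
  have -> : (samples_state rho s *t M) *m (A + A^†) =
            ((A + A^†) *m (samples_state rho s *t M^†))^†.
    by rewrite adjmxM adjmx_tens adjmxK hS adjmxD adjmxK (addrC A).
  by rewrite ptr_adj pG adjmxM adjmxK hH.
rewrite traced_branch_map2 (kraus1_adj _ _ cz) kraus2_adj 2!conj_scaled 2!ptrZ -scalerDr -ptrD.
rewrite (kraus_pair A _ zz); congr (_ *: _).
rewrite ptrD ptrD ptrN ptrZ ptrZ ptrD ptrN pG pG' ptr_tens tS scale1r.
by [].
Qed.

Lemma step_branch (s : seq 'I_K) (th phi : R) :
  exists b T : branch R K dA,
  [/\ br_seq b = s, trace_preserving b, trace_preserving T &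
    forall rho, (forall j, density (rho j)) -> forall M,
    branch_map rho b M = ((1 + th ^+ 2)^-1)%:RC *:
      (M - Complex 0 th *: (Hterm rho phi s *m M - M *m Hterm rho phi s)
       + (th ^+ 2)%:RC *: branch_map rho T M)].
Proof.
have [W [W1 W2 hW]] := shift_exists R dA s.
have [al [al2 calE]] : exists al : C, conjc al * al = (th ^+ 2 / 4)%:RC /\
    (al = th%:RC * (2%:R^-1 * cexpi phi) /\ conjc al = th%:RC * (2%:R^-1 * cexpi (- phi))).
  exists (th%:RC * (2%:R^-1 * cexpi phi)).
  rewrite !conjcM conjc_RC conjc_inv conjc_nat conjc_cexpi; split; last by [].
  rewrite -conjc_cexpi.
  have -> : th%:RC * (2%:R^-1 * conjc (cexpi phi)) * (th%:RC * (2%:R^-1 * cexpi phi)) =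
     (th%:RC * th%:RC * (2%:R^-1 * 2%:R^-1)) * (conjc (cexpi phi) * cexpi phi) by ring.
  rewrite cexpi_conjM mulr1.
  have -> : 2%:R^-1 = (2%:R^-1)%:RC :> C by rewrite fmorphV rmorph_nat.
  by rewrite -!rmorphM; congr (_%:RC); field.
have [z [zz cz zE]] : exists z : C,
    [/\ z * z = -1, conjc z = - z & forall x, z * x%:RC = Complex 0 x].
  exists (Complex 0 1); split; first by rewrite -expr2 sqr_i.
    by apply/eqP; rewrite eq_complex /= oppr0 !eqxx.
  by move=> x; apply/eqP; rewrite eq_complex /=; apply/andP; split; apply/eqP; ring.
have [A [eA1 eA2]] : exists A : 'M[C]_(dA ^ size s * dA), A = al *: W /\ A^† = conjc al *: W^†.
  by exists (al *: W); rewrite adjmxZ.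
have AA1 : A^† *m A = (th ^+ 2 / 4)%:RC%:M.
  by rewrite eA2 eA1 -scalemxAl -scalemxAr W1 scalerA al2 scalemx1.
have AA2 : A *m A^† = (th ^+ 2 / 4)%:RC%:M.
  by rewrite eA2 eA1 -scalemxAl -scalemxAr W2 scalerA mulrC al2 scalemx1.
have th0 : 0 < 1 + th ^+ 2 by rewrite ltr_pwDl ?sqr_ge0.
have [nu nu2] : exists nu : R, nu%:RC * nu%:RC = ((1 + th ^+ 2)^-1)%:RC :> C.
  exists (Num.sqrt (1 + th ^+ 2))^-1.
  by rewrite -rmorphM /= -invfM -expr2 sqr_sqrtr // ltW.
have [mu mu2] : exists mu : R, mu%:RC * mu%:RC = (2^-1)%:RC :> C.
  by exists (Num.sqrt 2)^-1; rewrite -rmorphM /= -invfM -expr2 sqr_sqrtr.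
exists (traced_branch [:: nu%:RC *: (1%:M - z *: (A + A^†)); nu%:RC *: (A - A^†)]).
(* Equal mixture of [W] and [W^†]: the quadratic remainder is [2 (th^2 / 4)] times the sum of their
   two conjugations, hence [th^2] times this channel. *)
exists (traced_branch [:: mu%:RC *: W; mu%:RC *: W^†]).
split.
- by [].
- apply: traced_branch_tp2; rewrite (kraus1_adj _ _ cz) kraus2_adj 2!gram_scaled nu2.
  rewrite -scalerDr (kraus_pair_gram zz AA1 AA2) scale_scalar_mx; congr (_%:M).
  have -> : 1 + 4%:R * (th ^+ 2 / 4)%:RC = (1 + th ^+ 2)%:RC :> C.
    rewrite [RHS]rmorphD rmorph1; congr (_ + _).
    by rewrite -(rmorph_nat (real_complex R) 4) -rmorphM; congr (_%:RC); field.
  by rewrite -rmorphM mulVf ?gt_eqF // rmorph1.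
- apply: traced_branch_tp2; rewrite 2!adjmxZR adjmxK 2!gram_scaled mu2 W1 W2.
  by rewrite -scalerDl -rmorphD (_ : 2^-1 + 2^-1 = 1) ?scale1r //; field.
move=> rho hr M.
have hh j : (rho j)^† = rho j by have [[]] := hr j.
have hH := Hterm_herm phi s hh.
rewrite [LHS](@step_map rho s A (th%:RC *: Hterm rho phi s) M nu z zz cz hr); last 2 first.
- by rewrite adjmxZR hH.
- move=> N; have [p1 p2] := hW rho N.
  rewrite mulmxDl ptrD eA2 eA1 -2!scalemxAl 2!ptrZ p1 p2.
  have [-> ->] := calE.
  rewrite /Hterm -!scalemxAl mulmxDl -2!scalemxAl.
  by rewrite !scalerDr !scalerA !mulrA.
rewrite nu2 -scalemxAl -scalemxAr -scalerBr scalerA zE; congr (_ *: (_ + _)).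
rewrite traced_branch_map2 !adjmxZR adjmxK 2!conj_scaled mu2 2!ptrZ -scalerDr scalerA.
rewrite eA2 eA1 -!scalemxAl -!scalemxAr ptrD !ptrZ !scalerA [al * _]mulrC al2 -scalerDr scalerA.
congr (_ *: _).
rewrite -(rmorph_nat (real_complex R) 2) -!rmorphM; congr (_%:RC).
by field.
Qed.

End StepBranch.

(** * Random choice of the word, and iteration *)

Section StepProtocol.
Variables (R : realType) (K dA : nat).
Local Notation C := (complex R).
Implicit Types (rho : 'I_K -> 'M[C]_dA).

(** The hypothesis is instantiated with the probability [p] of a word: [(|c_r| / c)] times the
    signed angle equals [th / c] times [c_r]. *)
Lemma scale_step m n (p q a a' c t : C) (M A B T : 'M[C]_(m, n)) : p * a = a' * c ->
  p *: (q *: (M - a *: (A - B) + t *: T)) =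
  q *: (p *: M - a' *: (c *: A - c *: B) + t *: (p *: T)).
Proof.
move=> pa; apply/matrixP => i j; rewrite !mxE.
have -> : a' * (c * A i j - c * B i j) = p * a * (A i j - B i j) by rewrite pa; ring.
ring.
Qed.

Lemma step_protocol (Rs : seq (seq 'I_K)) (c phi : seq 'I_K -> R) (th : R) :
  0 < ctot Rs c ->
  exists P T : protocol R K dA,
  [/\ valid_protocol P, valid_protocol T, (max_samples P <= Lmax Rs)%N,
    forall j, expected_copies P j = kappa Rs c j &
    forall rho, (forall j, density (rho j)) -> forall dB (s : 'M[C]_(dA * dB)),
    protocol_out rho P s = ((1 + th ^+ 2)^-1)%:RC *:
      (s - Complex 0 (th / ctot Rs c) *:
         ((Hsum rho Rs c phi *t 1%:M) *m s - s *m (Hsum rho Rs c phi *t 1%:M))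
       + (th ^+ 2)%:RC *: protocol_out rho T s)].
Proof.
(* This sign is 1, not 0, when [c r = 0]: its square is always 1, so all words share the factor
   [1 / (1 + th^2)] and their average stays in the same form. *)
move=> cc0; pose sg r : R := (-1) ^+ (c r < 0)%R.
have sg2 r : sg r ^+ 2 = 1 by rewrite /sg sqrr_sign.
have hb r : exists bT : branch R K dA * branch R K dA,
  [/\ br_seq bT.1 = r, trace_preserving bT.1, trace_preserving bT.2 &
    forall rho, (forall j, density (rho j)) -> forall M,
    branch_map rho bT.1 M = ((1 + th ^+ 2)^-1)%:RC *:
      (M - Complex 0 (th * sg r) *: (Hterm rho (phi r) r *m M - M *m Hterm rho (phi r) r)
       + (th ^+ 2)%:RC *: branch_map rho bT.2 M)].
  have [b [T [h1 h2 h3 h4]]] := step_branch dA r (th * sg r) (phi r).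
  exists (b, T); split=> // rho hr M; rewrite (h4 rho hr M).
  by rewrite exprMn sg2 mulr1.
have [f hf] := choice _ hb.
pose p r := `|c r| / ctot Rs c.
have p0 r : 0 <= p r by rewrite divr_ge0 // ltW.
have psum : \sum_(r <- Rs) p r = 1 by rewrite -mulr_suml divff // gt_eqF.
exists [seq (p r, (f r).1) | r <- Rs], [seq (p r, (f r).2) | r <- Rs]; split.
- split; last by rewrite big_map.
  move=> pb hpb; have [r _ ->] := In_map hpb; have [_ h1 _ _] := hf r.
  by split; [exact: p0|exact: h1].
- split; last by rewrite big_map.
  move=> pb hpb; have [r _ ->] := In_map hpb; have [_ _ h2 _] := hf r.
  by split; [exact: p0|exact: h2].
- rewrite /max_samples /Lmax big_map.
  rewrite (eq_bigr (fun r => size r)) // => r _ /=.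
  by have [-> _ _ _] := hf r.
- move=> j; rewrite /expected_copies /kappa big_map mulr_suml; apply: eq_bigr => r _ /=.
  by have [-> _ _ _] := hf r; rewrite /p mulrC mulrA.
move=> rho hr dB.
have Hadd (H : 'M[C]_(dA * dB)) (a : C) x y :
    a *: (H *m (x + y) - (x + y) *m H) = a *: (H *m x - x *m H) + a *: (H *m y - y *m H).
  rewrite -scalerDr; congr (_ *: _).
  by rewrite mulmxDr mulmxDl opprD addrACA.
apply: (tens_additive_ext (F := protocol_out rho _)
  (G := fun s => _ *: (s - _ *: (_ *m s - s *m _) + _ *: protocol_out rho _ s))).
- exact: protocol_outD.
- move=> x y; rewrite Hadd protocol_outD -[RHS]scalerDr; congr (_ *: _).
  by rewrite [(th ^+ 2)%:RC *: (_ + _)]scalerDr opprD [x + y + _]addrACA [LHS]addrACA.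
move=> M N; rewrite !protocol_out_tens !big_map !tensmx_mul mul1mx mulmx1.
rewrite -tensmxNl -tensmxDl -!tensmxZl -tensmxNl -!tensmxDl -tensmxZl; congr (_ *t N).
transitivity (\sum_(r <- Rs) ((1 + th ^+ 2)^-1)%:RC *: ((p r)%:RC *: M
   - Complex 0 (th / ctot Rs c) *: ((c r)%:RC *: (Hterm rho (phi r) r *m M) -
                                    (c r)%:RC *: (M *m Hterm rho (phi r) r))
   + (th ^+ 2)%:RC *: ((p r)%:RC *: branch_map rho (f r).2 M))).
  apply: eq_bigr => r _ /=; have [_ _ _ ->] := hf r => //.
  apply: scale_step; rewrite {1}(realEsign (num_real (c r))) -/(sg r) /p.
  by apply/eqP; rewrite eq_complex /=; apply/andP; split; apply/eqP; ring.
rewrite -scaler_sumr; congr (_ *: _).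
rewrite big_split -scaler_sumr; congr (_ + _).
rewrite sumrB -scaler_suml -rmorph_sum psum rmorph1 scale1r; congr (_ - _).
rewrite -scaler_sumr sumrB /Hsum mulmx_suml mulmx_sumr; congr (_ *: (_ - _)).
  by apply: eq_bigr => r _; exact: scalemxAl.
by apply: eq_bigr => r _; exact: scalemxAr.
Qed.

(** With no samples the ancillary space has dimension [dA ^ 0 = 1]; the identity channel starts the
    iteration and settles the trivial evolution. *)
Definition idle_protocol : protocol R K dA :=
  [:: (1, @traced_branch R K dA [::] [:: 1%:M])].

Lemma idle_valid : valid_protocol idle_protocol.
Proof.
split; last by rewrite big_seq1.
move=> _ [<-|//] /=; split=> //; apply: traced_branch_tp.
by rewrite big_seq1 adjmx1 mul1mx.
Qed.

Lemma idle_out rho dB (s : 'M[C]_(dA * dB)) : protocol_out rho idle_protocol s = s.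
Proof.
apply: (tens_additive_ext (F := protocol_out rho idle_protocol) (G := id)).
- exact: protocol_outD.
- by [].
move=> M N; rewrite protocol_out_tens big_seq1 /= scale1r; congr (_ *t N).
by rewrite traced_branch_map big_seq1 adjmx1 mul1mx mulmx1 ptr_tens mxtrace1 scale1r.
Qed.

Lemma idle_max : max_samples idle_protocol = 0%N.
Proof. by rewrite /max_samples big_seq1. Qed.

Lemma idle_copies j : expected_copies idle_protocol j = 0.
Proof. by rewrite /expected_copies big_seq1 mulr0. Qed.

Definition protocol_iter (P : protocol R K dA) n := iter n (protocol_comp P) idle_protocol.

Lemma protocol_iter_valid P n : valid_protocol P -> valid_protocol (protocol_iter P n).
Proof.
move=> vP; elim: n => [|n IH]; first exact: idle_valid.
exact: protocol_comp_valid.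
Qed.

Lemma protocol_iter_max P n : (max_samples (protocol_iter P n) <= n * max_samples P)%N.
Proof.
elim: n => [|n IH]; first by rewrite idle_max.
by apply: leq_trans (protocol_comp_max _ _) _; rewrite mulSn leq_add2l.
Qed.

Lemma protocol_iter_copies P n j : valid_protocol P ->
  expected_copies (protocol_iter P n) j = n%:R * expected_copies P j.
Proof.
move=> vP; elim: n => [|n IH]; first by rewrite idle_copies mul0r.
rewrite [protocol_iter _ _]/(protocol_comp P (protocol_iter P n)).
rewrite protocol_comp_copies //; last exact: protocol_iter_valid.
by rewrite IH -[n.+1%:R]natr1 mulrDl mul1r addrC.
Qed.

End StepProtocol.

(** * Norm of the Hamiltonian and error analysis *)

Section Error.
Variable R : realType.
Local Notation C := (complex R).

(** Nonnegative eigenvalues of sum 1 are at most 1. Operator norm bounds are expressed throughout as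
    positivity of [k - A^† A]. *)
Lemma density_contraction n (r : 'M[C]_n) : density r -> psdmx (1%:M - r^† *m r).
Proof.
move=> [pr tr]; have [V [l [VV l0 e]]] := psdmx_spectral pr.
have l1 i : l i <= 1.
  move: tr; rewrite e udiag_tr // -rmorph_sum => /(@complexI R) <-.
  by rewrite (bigD1 i) //= lerDl sumr_ge0.
rewrite e udiag_adj -(udiag_cst VV) udiagM // udiagB.
have -> : (fun i => 1 - conjc (l i)%:RC * (l i)%:RC) =
    (fun i => (1 - l i * l i)%:RC) :> ('I_n -> C).
  by apply/funext => i; rewrite conjc_RC rmorphB rmorph1 rmorphM.
by apply: psdmx_udiag => i; rewrite subr_ge0 mulr_ile1.
Qed.

(** [1 - B^† A^† A B = B^† (1 - A^† A) B + (1 - B^† B)]. *)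
Lemma contraction_mul n (A B : 'M[C]_n) :
  psdmx (1%:M - A^† *m A) -> psdmx (1%:M - B^† *m B) ->
  psdmx (1%:M - (A *m B)^† *m (A *m B)).
Proof.
move=> pA pB; have := psdmxD (psdmx_conj B^† pA) pB.
rewrite adjmxK mulmxBr mulmxBl mulmx1 adjmxM.
by rewrite addrC addrA subrK !mulmxA.
Qed.

(** The matrix is half of [(1 + B)^† (1 + B) + (1 - B^† B)]. *)
Lemma contraction_re n (B : 'M[C]_n) : psdmx (1%:M - B^† *m B) ->
  psdmx (1%:M + 2%:R^-1 *: (B + B^†)).
Proof.
move=> pB.
have h2 : 0 <= 2^-1 :> R by rewrite invr_ge0.
have := psdmxZ h2 (psdmxD (psdmx_gram (1%:M + B)) pB).
have e2 : (2^-1)%:RC = 2%:R^-1 :> C by rewrite fmorphV rmorph_nat.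
rewrite e2; set X := _ *: _; suff -> : X = 1%:M + 2%:R^-1 *: (B + B^†) by [].
rewrite /X adjmxD adjmx1 mulmxDl !mulmxDr !mul1mx !mulmx1.
move: (B^† *m B) (B^†) => x y; apply/matrixP => i j; rewrite !mxE.
by field.
Qed.

Lemma Hterm_bound K n (rho : 'I_K -> 'M[C]_n) phi s : (forall j, density (rho j)) ->
  psdmx (1%:M + Hterm rho phi s) /\ psdmx (1%:M - Hterm rho phi s).
Proof.
move=> hr; have hh j : (rho j)^† = rho j by have [[]] := hr j.
have pw : psdmx (1%:M - (word_prod rho s)^† *m word_prod rho s).
  elim: s => [|j s IH]; first by rewrite /word_prod big_nil adjmx1 mul1mx subrr; apply: psdmx0.
  rewrite /word_prod big_cons; exact: (contraction_mul (density_contraction (hr j)) IH).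
have key (x : C) : conjc x * x = 1 ->
    psdmx (1%:M + 2%:R^-1 *: (x *: word_prod rho s + conjc x *: word_prod rho (rev s))).
  move=> xx; have := @contraction_re _ (x *: word_prod rho s).
  rewrite adjmxZ -scalemxAl -scalemxAr scalerA xx scale1r word_prod_adj //; apply.
  by rewrite -word_prod_adj.
rewrite /Hterm -conjc_cexpi; split; first by apply: key; apply: cexpi_conjM.
(* Negating the phase factor changes [Hterm] into its opposite, so the second bound is another case
   of the first. *)
have := key (- cexpi phi); rewrite (rmorphN (@conjc R)) mulrNN cexpi_conjM => /(_ erefl).
by rewrite !scaleNr -opprD scalerN.
Qed.

Lemma Hsum_bound K n (rho : 'I_K -> 'M[C]_n) Rs c phi : (forall j, density (rho j)) ->
  psdmx ((ctot Rs c)%:RC%:M + Hsum rho Rs c phi) /\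
  psdmx ((ctot Rs c)%:RC%:M - Hsum rho Rs c phi).
Proof.
move=> hr; rewrite /ctot /Hsum rmorph_sum /= -scalemx1 scaler_suml.
rewrite -sumrN -!big_split /=.
split; apply: psdmx_sum => r _; have [h1 h2] := Hterm_bound (phi r) r hr.
  case: (ger0P (c r)) => [c0|/ltW c0]; first by rewrite -scalerDr; apply: psdmxZ.
  rewrite -[X in _ + X *: _]opprK -rmorphN scaleNr -scalerBr.
  by apply: psdmxZ => //; rewrite oppr_ge0.
case: (ger0P (c r)) => [c0|/ltW c0]; first by rewrite -scalerBr; apply: psdmxZ.
rewrite -scaleNr -rmorphN -scalerDr.
by apply: psdmxZ => //; rewrite oppr_ge0.
Qed.

Lemma Hsum_spectral K n (rho : 'I_K -> 'M[C]_n) Rs c phi : (forall j, density (rho j)) ->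
  exists V (l : 'I_n -> R), [/\ V *m V^† = 1%:M,
    Hsum rho Rs c phi = udiag V (fun i => (l i)%:RC) & forall i, `|l i| <= ctot Rs c].
Proof.
move=> hr; have hh j : (rho j)^† = rho j by have [[]] := hr j.
have hH : (Hsum rho Rs c phi)^† = Hsum rho Rs c phi.
  rewrite /Hsum adjmx_sum; apply: eq_bigr => r _.
  by rewrite adjmxZR Hterm_herm.
have [V [l [VV e]]] := herm_spectral hH.
exists V, l; split=> // i; have [h1 h2] := Hsum_bound Rs c phi hr.
move: h1 h2; rewrite e -(udiag_cst VV) udiagB udiagD => h1 h2.
have := psdmx_diag_ge0 i (psdmx_conj V h1); rewrite udiag_entry // -rmorphD ler0c => q1.
have := psdmx_diag_ge0 i (psdmx_conj V h2); rewrite udiag_entry // -rmorphB ler0c => q2.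
by rewrite ler_norml -subr_ge0 opprK addrC q1 -subr_ge0 q2.
Qed.

Lemma udiag_tens_bound n m (V : 'M[C]_n) (g : 'I_n -> C) (h : 'I_n -> R) (k : R) :
  V *m V^† = 1%:M -> (forall i, conjc (g i) * g i = (h i)%:RC) ->
  (forall i, h i <= k) ->
  psdmx (k%:RC%:M - (udiag V g *t (1%:M : 'M[C]_m))^† *m (udiag V g *t 1%:M)).
Proof.
move=> VV gh hk.
have -> : (k%:RC%:M : 'M[C]_(n * m)) = (k%:RC%:M : 'M[C]_n) *t (1%:M : 'M[C]_m).
  by rewrite -[LHS]scalemx1 -tensmx11 -tensmxZl scalemx1.
rewrite adjmx_tens adjmx1 tensmx_mul mul1mx -tensmxNl -tensmxDl.
apply: psdmx_tens; last by have := psdmx_gram (1%:M : 'M[C]_m); rewrite adjmx1 mul1mx.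
rewrite udiag_adj -(udiag_cst VV) udiagM // udiagB.
have -> : (fun i => k%:RC - conjc (g i) * g i) = (fun i => (k - h i)%:RC).
  by apply/funext => i; rewrite gh rmorphB.
by apply: psdmx_udiag => i; rewrite subr_ge0.
Qed.

(** With [Y = U - 1], [D = Y - X], [q = th^2] and [N = 1 / (1 + q)], the difference is [N q (s + X s
    + s X^†) + (D s + s D^†) + Y s Y^† - N q t]. The four pieces cost [2 q], [3 q], [2 q] and
    [q]. *)
Lemma step_error n (s t U X : 'M[C]_n) (th : R) :
  th != 0 -> density s -> density t ->
  psdmx ((th ^+ 2)%:RC%:M - X^† *m X) ->
  psdmx ((2 * th ^+ 2)%:RC%:M - (U - 1%:M)^† *m (U - 1%:M)) ->
  psdmx ((2 * th ^+ 4)%:RC%:M - (U - 1%:M - X)^† *m (U - 1%:M - X)) ->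
  trbound (U *m s *m U^† -
    ((1 + th ^+ 2)^-1)%:RC *: (s + (X *m s + s *m X^†) + (th ^+ 2)%:RC *: t))
    (8 * th ^+ 2).
Proof.
move=> th0 ds dt pX pY pD.
have [ps ts] := ds; have [pt tt] := dt.
have q0 : 0 < th ^+ 2 by rewrite exprn_even_gt0.
have n0 : 0 < 1 + th ^+ 2 by rewrite ltr_pwDl // ltW.
set N := (1 + th ^+ 2)^-1; have N0 : 0 < N by rewrite invr_gt0.
have Nq : N * th ^+ 2 = 1 - N by rewrite /N; field; rewrite gt_eqF.
have -> : U *m s *m U^† - N%:RC *: (s + (X *m s + s *m X^†) + (th ^+ 2)%:RC *: t) =
   (N * th ^+ 2)%:RC *: (s + (X *m s + s *m X^†)) +
   ((U - 1%:M - X) *m s + s *m (U - 1%:M - X)^†) +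
   (U - 1%:M) *m s *m (U - 1%:M)^† - (N * th ^+ 2)%:RC *: t.
  rewrite !adjmxB adjmx1 !(mulmxDl, mulmxDr, mulmxN, mulNmx, mul1mx, mulmx1).
  have -> : N%:RC *: (s + (X *m s + s *m X^†) + (th ^+ 2)%:RC *: t) =
    N%:RC *: s + N%:RC *: (X *m s + s *m X^†) + (N * th ^+ 2)%:RC *: t.
    by rewrite 2!scalerDr scalerA -rmorphM.
  have -> : N%:RC = 1 - (N * th ^+ 2)%:RC :> C.
    by rewrite Nq rmorphB rmorph1 opprB addrC subrK.
  move: (N * th ^+ 2)%:RC (U *m s *m U^†) => q x1.
  move: (U *m s) (s *m U^†) (X *m s) (s *m X^†) => x2 x3 x4 x5.
  by apply/matrixP => i j; rewrite !mxE; ring.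
have a0 : 0 < `|th| by rewrite normr_gt0.
have aa : `|th| ^+ 2 = th ^+ 2 by rewrite real_normK ?num_real.
have b1 : trbound s 1 by apply: trbound_psd => //; rewrite ts.
have b2 : trbound t 1 by apply: trbound_psd => //; rewrite tt.
have b3 : trbound (X *m s + s *m X^†) (2 * `|th|).
  (* The parameter [e = 1 / |th|] balances [e th^2] and [1 / e]. *)
  have ia0 : 0 < `|th|^-1 by rewrite invr_gt0.
  apply: trbound_le (trbound_anticomm ds ia0 pX).
  by rewrite invrK -aa expr2 mulKf ?gt_eqF // -mulr2n mulr_natl.
have b4 : trbound ((U - 1%:M - X) *m s + s *m (U - 1%:M - X)^†) (3 * th ^+ 2).
  (* Here [e = th^(-2)] gives [e (2 th^4) + 1 / e = 3 th^2]. *)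
  have iq0 : 0 < (th ^+ 2)^-1 by rewrite invr_gt0.
  apply: trbound_le (trbound_anticomm ds iq0 pD).
  by rewrite le_eqVlt; apply/orP; left; apply/eqP; field.
have b5 : trbound ((U - 1%:M) *m s *m (U - 1%:M)^†) (2 * th ^+ 2).
  by apply: trbound_psd; [exact: psdmx_conj|exact: tr_conj_le].
have Nq0 : 0 <= N * th ^+ 2 by rewrite mulr_ge0 ?ltW.
have b6 := trboundD (trboundD (trboundZ Nq0 (trboundD b1 b3)) b4) b5.
apply: trbound_le (trboundB b6 (trboundZ Nq0 b2)).
have N1 : N * (1 + th ^+ 2) = 1 by rewrite /N mulVf ?gt_eqF.
(* From [1 + 2 |th| <= 2 (1 + th^2)]; the factor [1 + th^2] is cancelled by [N], whatever the size
   of [th]. *)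
have h1 : N * th ^+ 2 * (1 + 2 * `|th|) <= 2 * th ^+ 2.
  have -> : 2 * th ^+ 2 = N * th ^+ 2 * (2 * (1 + th ^+ 2)).
    have -> : N * th ^+ 2 * (2 * (1 + th ^+ 2)) = N * (1 + th ^+ 2) * (2 * th ^+ 2) by ring.
    by rewrite N1 mul1r.
  apply: ler_wpM2l => //; rewrite -aa.
  have : 0 <= (`|th| - 1) ^+ 2 by apply: sqr_ge0.
  nra.
have h2 : N * th ^+ 2 * 1 <= th ^+ 2 by nra.
lra.
Qed.

End Error.


(** * Choice of the number of steps and accumulation of errors *)

Theorem mainTheorem12 (R : realType) :
  exists Cst : R, 0 < Cst /\
  forall (K dA : nat) (Rs : seq (seq 'I_K)) (c phi : seq 'I_K -> R) (t delta : R),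
    uniq Rs ->
    (forall r, r \in Rs -> (0 < size r)%N) ->
    0 < delta ->
    let cc := ctot Rs c in
    let L := Lmax Rs in
    exists P : protocol R K dA,
      valid_protocol P /\
      (max_samples P)%:R <= Cst * L%:R * (cc ^+ 2 * t ^+ 2 / delta + 1) /\
      (forall j : 'I_K,
         expected_copies P j <= Cst * kappa Rs c j * (cc ^+ 2 * t ^+ 2 / delta + 1)) /\
      forall (dB : nat) (rho : 'I_K -> 'M[complex R]_dA)
             (sigma : 'M[complex R]_(dA * dB)),
        (forall j, density (rho j)) ->
        density sigma ->
        let H := Hsum rho Rs c phi in
        let U := expmx (Complex 0 (- t) *: H) in
        let UB := U *t (1%:M : 'M[complex R]_dB) in
        (2%:R)^-1 * trnorm (UB *m sigma *m adjmx UB - protocol_out rho P sigma)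
          <= Cst * delta.
Proof.
(* Half of the accumulated trace norm bound [8 delta]; the sample counts would already fit with
   constant 1. *)
exists 4; split=> // K dA Rs c phi t delta _ _ d0 cc L.
have cc0 : 0 <= cc by apply: sumr_ge0.
have kap0 j : 0 <= kappa Rs c j.
  by apply: divr_ge0 => //; apply: sumr_ge0 => r _; apply: mulr_ge0.
pose x := cc ^+ 2 * t ^+ 2 / delta.
have x0 : 0 <= x by apply: divr_ge0; [apply: mulr_ge0; apply: sqr_ge0|exact: ltW].
have x1 : 0 <= x + 1 by apply: addr_ge0.
have expE (rho : 'I_K -> 'M[complex R]_dA) (hr : forall j, density (rho j)) :
   exists V l, [/\ V *m V^† = 1%:M,
   Hsum rho Rs c phi = udiag V (fun i => (l i)%:RC), forall i, `|l i| <= cc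
   & expmx (Complex 0 (- t) *: Hsum rho Rs c phi) = udiag V (fun i => cexpi (- (t * l i)))].
  have [V [l [VV e lb]]] := Hsum_spectral Rs c phi hr.
  exists V, l; split=> //; rewrite e udiagZ -(expmx_udiag _ VV); congr (expmx (udiag V _)).
  apply/funext => i; apply/eqP; rewrite eq_complex /=.
  by apply/andP; split; apply/eqP; ring.
(* When [c t = 0] the evolution is the identity, because every eigenvalue of [t H] is at most
   [|c t|] in modulus. Otherwise [c > 0] gives the word probabilities and [th] is nonzero. *)
have [ct0|ct0] := eqVneq (cc * t) 0.
  exists (idle_protocol R K dA); split; first exact: idle_valid.
  split; first by rewrite idle_max !mulr_ge0.
  split; first by move=> j; rewrite idle_copies; apply: mulr_ge0 => //; apply: mulr_ge0.
  move=> dB rho sigma hr hs /=; have [V [l [VV e lb ->]]] := expE rho hr.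
  have -> : (fun i => cexpi (- (t * l i))) = (fun=> 1).
    apply/funext => i; have -> : t * l i = 0.
      apply/eqP; rewrite -normr_le0 normrM.
      apply: le_trans (ler_wpM2l (normr_ge0 t) (lb i)) _.
      by rewrite -[cc]ger0_norm // -normrM mulrC ct0 normr0.
    by rewrite oppr0 /cexpi cos0 sin0.
  rewrite (udiag_cst VV) tensmx11 adjmx1 mul1mx mulmx1 idle_out subrr.
  apply: (@le_trans _ _ 0); last by rewrite mulr_ge0 // ltW.
  rewrite pmulr_rle0 ?invr_gt0 //; apply: trnorm_le; apply: trbound_psd; first exact: psdmx0.
  by rewrite mxtrace0.
have ccp : 0 < cc.
  move: ct0; rewrite mulf_eq0 negb_or => /andP[cn0 _].
  by rewrite lt_neqAle eq_sym cn0.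
(* Rounding [x] up by [truncn x + 1] keeps [n] positive even for small [x]; this is the source of
   the [+ 1] in the sample counts. *)
have [n [n0 xn nx]] : exists n : nat, [/\ 0 < n%:R :> R, x < n%:R & n%:R <= x + 1].
  exists (Num.truncn x).+1; split; [by rewrite ltr0n|exact: truncnS_gt|].
  by rewrite -natr1 lerD2r truncn_le.
pose s := t / n%:R; pose th := cc * s.
have th0 : th != 0 by rewrite /th /s mulrA mulf_neq0 // invr_neq0 // gt_eqF.
have [P [T [vP vT mP cP oP]]] := step_protocol dA phi th ccp.
exists (protocol_iter P n); split; first exact: protocol_iter_valid.
split.
  apply: (@le_trans _ _ (n%:R * L%:R)).
    rewrite -natrM ler_nat; apply: leq_trans (protocol_iter_max P n) _.
    by rewrite leq_mul2l mP orbT.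
  rewrite -/x -mulrA; apply: (@le_trans _ _ (L%:R * (x + 1))).
    by rewrite mulrC; apply: ler_wpM2l.
  by rewrite ler_peMl ?mulr_ge0 // ler1n.
split.
  move=> j; rewrite (protocol_iter_copies _ _ vP) cP -/x -mulrA.
  apply: (@le_trans _ _ (kappa Rs c j * (x + 1))).
    by rewrite mulrC; apply: ler_wpM2l.
  have kx : 0 <= kappa Rs c j * (x + 1) by exact: mulr_ge0.
  by rewrite ler_peMl // ler1n.
move=> dB rho sigma hr hs /=.
have [V [l [VV e lb ->]]] := expE rho hr.
(* Eigenangles of one step of duration [s]; [|l i| <= c] bounds them by [|th|]. *)
pose y i := - (s * l i).
have yb i : `|y i| <= `|th|.
  rewrite /y normrN /th (normrM s) (normrM cc) [`|cc| * _]mulrC ler_wpM2l // (ger0_norm cc0).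
  exact: lb.
have yb2 i : y i ^+ 2 <= th ^+ 2.
  by rewrite -real_normK ?num_real // -[leRHS]real_normK ?num_real // lerXn2r ?nnegrE.
have yb4 i : y i ^+ 4 <= th ^+ 4.
  by rewrite -[4%N]/(2 * 2)%N !exprM lerXn2r ?nnegrE ?sqr_ge0.
pose Uk k := udiag V (fun i => cexpi (y i *+ k)) *t (1%:M : 'M[complex R]_dB).
have -> : udiag V (fun i => cexpi (- (t * l i))) *t (1%:M : 'M[complex R]_dB) = Uk n.
  congr (udiag V _ *t _); apply/funext => i; congr cexpi.
  by rewrite /y /s -mulr_natl; field; rewrite gt_eqF.
have UkS k : Uk k.+1 = Uk 1%N *m Uk k.
  rewrite /Uk tensmx_mul mul1mx udiagM //; congr (udiag V _ *t _).
  by apply/funext => i; rewrite -!cexpiM expr1 exprS.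
have UU : (Uk 1%N)^† *m Uk 1%N = 1%:M.
  rewrite /Uk adjmx_tens adjmx1 tensmx_mul mul1mx udiag_adj udiagM //.
  have -> : (fun i => conjc (cexpi (y i *+ 1)) * cexpi (y i *+ 1)) = (fun=> 1).
    by apply/funext => i; rewrite cexpi_conjM.
  by rewrite (udiag_cst VV) tensmx11.
have U1 : Uk 1%N - 1%:M = udiag V (fun i => cexpi (y i) - 1) *t 1%:M.
  by rewrite -udiagB tensmxDl tensmxNl (udiag_cst VV) tensmx11.
pose X := udiag V (fun i => Complex 0 (y i)) *t (1%:M : 'M[complex R]_dB).
have U2 : Uk 1%N - 1%:M - X = udiag V (fun i => cexpi (y i) - 1 - Complex 0 (y i)) *t 1%:M.
  by rewrite U1 /X -tensmxNl -tensmxDl udiagB.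
have XH : X = Complex 0 (- s) *: (Hsum rho Rs c phi *t 1%:M).
  rewrite /X e -tensmxZl udiagZ; congr (udiag V _ *t _); apply/funext => i.
  by apply/eqP; rewrite eq_complex /= /y; apply/andP; split; apply/eqP; ring.
have Xa : X^† = - X.
  rewrite /X adjmx_tens adjmx1 udiag_adj -tensmxNl udiagN; congr (udiag V _ *t _).
  by apply/funext => i; apply/eqP; rewrite eq_complex /= oppr0 !eqxx.
have step z : density z -> trbound (Uk 1%N *m z *m (Uk 1%N)^† - protocol_out rho P z) (8 * th ^+ 2).
  move=> dz; have dT := protocol_out_density hr vT dz.
  have -> : protocol_out rho P z = ((1 + th ^+ 2)^-1)%:RC *:
     (z + (X *m z + z *m X^†) + (th ^+ 2)%:RC *: protocol_out rho T z).
    rewrite (oP rho hr); congr (_ *: (_ + _ + _)).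
    rewrite Xa mulmxN XH -scalemxAl -scalemxAr -scalerBr -scaleNr; congr (_ *: _).
    rewrite /th -/cc mulrAC divff ?gt_eqF // mul1r.
    by apply/eqP; rewrite eq_complex /= oppr0 !eqxx.
  apply: (step_error th0 dz dT).
  - apply: (udiag_tens_bound _ (h := fun i => y i ^+ 2) VV) => // i.
    by apply/eqP; rewrite eq_complex /=; apply/andP; split; apply/eqP; ring.
  - rewrite U1; apply: (udiag_tens_bound _ VV (fun i => cexpi_sub1_sqr (y i))) => i.
    rewrite ler_pM2l //; apply: le_trans (yb2 i).
    by have := normr_cos1_le (y i); rewrite ler_norml => /andP[]; lra.
  - rewrite U2; apply: (udiag_tens_bound _ VV (fun i => cexpi_sub2_sqr (y i))) => i.
    apply: (@le_trans _ _ (2 * y i ^+ 4)); last by rewrite ler_pM2l.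
    have h a : `|a| <= y i ^+ 2 -> a ^+ 2 <= y i ^+ 4.
      move=> ha; rewrite -real_normK ?num_real // -[4%N]/(2 * 2)%N exprM.
      by rewrite lerXn2r ?nnegrE ?sqr_ge0.
    have := h _ (normr_cos1_le (y i)); have := h _ (normr_sinB_le (y i)).
    lra.
(* Hybrid argument: the old error is conjugated by the unitary of one step, which preserves its
   bound, and the new error is that of one step on the current output, still a density. *)
have main k : trbound
   (Uk k *m sigma *m (Uk k)^† - protocol_out rho (protocol_iter P k) sigma)
   (k%:R * (8 * th ^+ 2)).
  elim: k => [|k IH].
    have -> : Uk 0%N = 1%:M.
      rewrite /Uk -tensmx11 -(udiag_cst VV); congr (udiag V _ *t _); apply/funext => i.
      by rewrite mulr0n /cexpi cos0 sin0.
    rewrite adjmx1 mul1mx mulmx1 idle_out subrr mul0r.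
    by apply: trbound_psd; [exact: psdmx0|rewrite mxtrace0].
  rewrite [protocol_iter P k.+1]/(protocol_comp P (protocol_iter P k)) protocol_out_comp UkS.
  have dk := protocol_out_density hr (protocol_iter_valid k vP) hs.
  have := trboundD (trbound_unitary UU IH) (step _ dk).
  rewrite mulmxBr mulmxBl addrA subrK adjmxM !mulmxA.
  have -> : k.+1%:R * (8 * th ^+ 2) = k%:R * (8 * th ^+ 2) + 8 * th ^+ 2.
    by rewrite -natr1 mulrDl mul1r.
  exact.
have := trnorm_le (main n); set tn := trnorm _ => htn.
(* [n th^2 = c^2 t^2 / n = x delta / n], and [x < n]. *)
have thn : n%:R * th ^+ 2 <= delta.
  have -> : n%:R * th ^+ 2 = x * delta / n%:R.
    by rewrite /th /s /x; field; rewrite !gt_eqF.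
  rewrite ler_pdivrMr // mulrC; apply: ler_wpM2l; exact: ltW.
rewrite mulrC ler_pdivrMr //; apply: le_trans htn _.
lra.
Qed.
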